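(* Let $m,n\ge1$ be integers, let $1<p_1,\dots,p_m<\infty$ and let $p$ be defined by $\frac1p=\frac1{p_1}+\cdots+\frac1{p_m}$. Let $\mu$ be a Borel measure on $\mathbb{R}^{n+1}_+$, let $\overrightarrow{\omega}=(\omega_1,\dots,\omega_m)$ be weights on $\mathbb{R}^n$, and put $\sigma_i=\omega_i^{1-p_i'}$. If $\overrightarrow{\omega}$ satisfies the reverse Hölder condition $RH_{\overrightarrow{p}}$, then the following statements are equivalent: (1) There exists a positive constant $C$ such that $$\|\mathfrak{M}(f_1,\dots,f_m)\|_{L^p(\mathbb{R}^{n+1}_+,\mu)}\le C\prod_{i=1}^m\|f_i\|_{L^{p_i}(\mathbb{R}^n,\omega_i)}\qquad\text{for all } f_i\in L^{p_i}(\mathbb{R}^n,\omega_i),\ i=1,\dots,m.$$ (2) There exists a positive constant $C$ such that $$\|\mathfrak{M}(f_1\sigma_1,\dots,f_m\sigma_m)\|_{L^p(\mathbb{R}^{n+1}_+,\mu)}\le C\prod_{i=1}^m\|f_i\|_{L^{p_i}(\mathbb{R}^n,\sigma_i)}\qquad\text{for all } f_i\in L^{p_i}(\mathbb{R}^n,\sigma_i),\ i=1,\dots,m.$$ (3) $(\mu,\overrightarrow{\omega})$ satisfies the multilinear $S'_{\overrightarrow{p}}$ condition. Moreover, denoting the smallest constants $C$ in (1) and (2) by $\|\mathfrak{M}\|$ and $\|\mathfrak{M}\|'$ respectively, one has $$[\mu,\overrightarrow{\omega}]_{S'_{\overrightarrow{p}}}\le\|\mathfrak{M}\|=\|\mathfrak{M}\|'\le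 c\,[\overrightarrow{\omega}]_{RH_{\overrightarrow{p}}}^{1/p}\,[\mu,\overrightarrow{\omega}]_{S'_{\overrightarrow{p}}},$$ where $c>0$ is a constant depending only on $n,m,p_1,\dots,p_m$.
   Context: A weight on $\mathbb{R}^n$ is a nonnegative locally integrable function. $\|f\|_{L^{q}(\mathbb{R}^n,\omega)}=(\int_{\mathbb{R}^n}|f|^q\omega\,dx)^{1/q}$. All cubes $Q\subset\mathbb{R}^n$ have sides parallel to the coordinate axes, $|Q|$ is Lebesgue measure, $l(Q)$ is the side length, $\chi_Q$ is the indicator function. $p_i'=p_i/(p_i-1)$, and $\sigma(Q)=\int_Q\sigma\,dx$. $\mathbb{R}^{n+1}_+=\{(x,t):x\in\mathbb{R}^n,\ t\ge0\}$, and for a cube $Q\subset\mathbb{R}^n$, $\widetilde{Q}=\{(x,t)\in\mathbb{R}^{n+1}_+:x\in Q,\ 0\le t<l(Q)\}$. The multilinear maximal operator on the upper half-space is $$\mathfrak{M}(f_1,\dots,f_m)(x,t)=\sup_{Q\ni x,\ l(Q)\ge t}\ \prod_{i=1}^m\frac1{|Q|}\int_Q|f_i(y_i)|\,dy_i,$$ the supremum being over cubes $Q\subset\mathbb{R}^n$ with $x\in Q$ and $l(Q)\ge t$. With $\sigma_i=\omega_i^{1-p_i'}$: $\overrightarrow{\omega}$ satisfies the reverse Hölder condition $RH_{\overrightarrow{p}}$ if there is a constant $C$ such that for every cube $Q$ in $\mathbb{R}^n$ $$\prod_{i=1}^m\left(\int_Q\sigma_i\,dx\right)^{p/p_i}\le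 C\int_Q\prod_{i=1}^m\sigma_i^{p/p_i}\,dx;$$ the smallest such $C$ is denoted $[\overrightarrow{\omega}]_{RH_{\overrightarrow{p}}}$. $(\mu,\overrightarrow{\omega})$ satisfies the multilinear $S'_{\overrightarrow{p}}$ condition if $$[\mu,\overrightarrow{\omega}]_{S'_{\overrightarrow{p}}}=\sup_Q\left(\int_{\widetilde{Q}}\mathfrak{M}(\sigma_1\chi_Q,\dots,\sigma_m\chi_Q)^p\,d\mu\right)^{1/p}\left(\prod_{i=1}^m\sigma_i(Q)^{1/p_i}\right)^{-1}<\infty,$$ the supremum being over all cubes $Q$ in $\mathbb{R}^n$.
   Formalization: The weights are assumed positive almost everywhere, so that σ_i=ω_i^{1-p_i'} is defined (if ω_i vanishes on a set of positive measure, (2) can hold while (1) fails), and in the S' condition a quotient ∞/∞ is read as ∞. *)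

(* Defs.v *)
From HB Require Import structures.
From mathcomp Require Import all_boot all_order all_algebra.
From mathcomp Require Import all_classical all_reals all_analysis.

Set Implicit Arguments.
Unset Strict Implicit.
Unset Printing Implicit Defensive.

Import Order.TTheory GRing.Theory Num.Theory.
Import numFieldNormedType.Exports.

Local Open Scope classical_set_scope.
Local Open Scope ring_scope.

(* R^n, with its Borel (= product) sigma-algebra. *)
Notation euclidean R n := (n.-tuple (measurableTypeR R)).

Section LebesgueTuple.
Context {R : realType}.

Definition prepend n (z : measurableTypeR R * euclidean R n) :
  euclidean R n.+1 := [tuple of z.1 :: z.2].

Lemma measurable_prepend n : measurable_fun setT (@prepend n).
Proof. exact: (measurable_cons measurable_fst measurable_snd). Qed.

HB.instance Definition _ n :=
  @isMeasurableFun.Build _ _ _ _ (@prepend n) (@measurable_prepend n).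

Section lebesgue_cons.
Local Open Scope ereal_scope.
Variables (n : nat) (m : {measure set (euclidean R n) -> \bar R}).

Definition lebesgue_cons : set (euclidean R n.+1) -> \bar R :=
  pushforward (lebesgue_measure \x^ m) (@prepend n).

Let lebesgue_cons0 : lebesgue_cons set0 = 0.
Proof. exact: measure0. Qed.

Let lebesgue_cons_ge0 A : 0 <= lebesgue_cons A.
Proof. exact: measure_ge0. Qed.

Let lebesgue_cons_sigma_additive : semi_sigma_additive lebesgue_cons.
Proof. exact: measure_semi_sigma_additive. Qed.

HB.instance Definition _ := isMeasure.Build _ _ _ lebesgue_cons
  lebesgue_cons0 lebesgue_cons_ge0 lebesgue_cons_sigma_additive.

End lebesgue_cons.

(* n-dimensional Lebesgue measure, as an n-fold product. *)
Fixpoint lebesgue n : {measure set (euclidean R n) -> \bar R} :=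
  match n with
  | 0 => \d_([tuple] : euclidean R 0)
  | n'.+1 => lebesgue_cons (lebesgue n')
  end.

End LebesgueTuple.
Arguments lebesgue R n : clear implicits.

Section Cubes.
Context (R : realType) (n : nat).

Record cube := Cube {
  corner : euclidean R n;
  side : R;
  side_gt0 : 0 < side }.

(* Cubes are closed; they are never degenerate. *)
Definition cube_set (Q : cube) : set (euclidean R n) :=
  [set x | forall i : 'I_n,
     tnth (corner Q) i <= tnth x i <= tnth (corner Q) i + side Q].

End Cubes.
Coercion cube_set : cube >-> set.

Lemma lebesgue_box (R : realType) n (a b : euclidean R n) :
  (forall i, tnth a i <= tnth b i) ->
  lebesgue R n [set x | forall i, tnth a i <= tnth x i <= tnth b i] =
  (\prod_(i < n) (tnth b i - tnth a i))%:E.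
Proof.
elim: n a b => [a b _|n IH a b ab].
  by rewrite big_ord0 /= diracE mem_set// => -[].
pose a' := [tuple of behead a]; pose b' := [tuple of behead b].
pose B := [set x : euclidean R n | forall i, tnth a' i <= tnth x i <= tnth b' i].
have ta (c : euclidean R n.+1) i : tnth c (lift ord0 i) = tnth [tuple of behead c] i.
  by rewrite {1}(tuple_eta c) tnthS.
have mB : measurable B.
  rewrite (_ : B = \bigcap_(i in [set: 'I_n]) ((fun x => tnth x i) @^-1` `[tnth a' i, tnth b' i])).
    apply: fin_bigcap_measurable => // i _.
    rewrite -[X in measurable X]setTI; apply: measurable_tnth => //.
  apply/seteqP; split => [x Bx i _|x Bx i]; rewrite /= ?in_itv/=; first exact: Bx.
  by have := Bx i I; rewrite /= in_itv.
rewrite /= /lebesgue_cons /pushforward.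
rewrite (_ : _ @^-1` _ = `[tnth a ord0, tnth b ord0]%classic `*` B); last first.
  apply/seteqP; split => -[x y] /=.
    move=> H; split; first by have := H ord0; rewrite tnth0 in_itv.
    by move=> i; have := H (lift ord0 i); rewrite tnthS !ta.
  rewrite in_itv/= => -[H0 H] i; have [->|[j ->]] : i = ord0 \/ exists j, i = lift ord0 j.
  - by case: (unliftP ord0 i) => [j ->|->]; [right; exists j|left].
  - by rewrite tnth0.
  - by rewrite tnthS !ta.
rewrite product_measure2E//.
rewrite IH; last by move=> i; rewrite -!ta.
rewrite [X in (X * _)%E](lebesgue_measure_itv `[tnth a ord0, tnth b ord0]) /= lte_fin.
rewrite big_ord_recl.
under [in RHS]eq_bigr do rewrite !ta.
have := ab ord0; rewrite le_eqVlt => /predU1P[->|->]; last by rewrite -EFinB EFinM.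
by rewrite ltxx subrr mul0r mul0e.
Qed.

Lemma lebesgue_cube (R : realType) n (Q : cube R n) :
  lebesgue R n Q = (side Q ^+ n)%:E.
Proof.
have addl i : tnth [tuple tnth (corner Q) i + side Q | i < n] i =
  tnth (corner Q) i + side Q by rewrite tnth_mktuple.
rewrite (_ : cube_set Q = [set x | forall i, tnth (corner Q) i <= tnth x i <=
    tnth [tuple tnth (corner Q) i + side Q | i < n] i]).
  rewrite lebesgue_box => [|i]; last by rewrite addl lerDl ltW ?side_gt0.
  congr EFin; rewrite (eq_bigr (fun=> side Q)) => [|i _].
    by rewrite prodr_const card_ord.
  by rewrite addl addrAC subrr add0r.
by apply/seteqP; split => x Qx i; have := Qx i; rewrite addl.
Qed.

Section MultilinearMaximal.
Context (R : realType) (m n : nat).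
Local Open Scope ereal_scope.

Local Notation Rn := (euclidean R n).
Local Notation leb := (lebesgue R n).
Implicit Types (Q : cube R n) (f w : 'I_m -> Rn -> R) (ps : 'I_m -> R) (p q : R).

(* A Borel measure on the closed upper half-space is represented by a Borel
   measure on R^n * R, of which only the restriction to [half_space] is used. *)
Definition half_space : set (Rn * measurableTypeR R) := [set z | (0 <= z.2)%R].

Definition tent Q : set (Rn * measurableTypeR R) :=
  [set z | cube_set Q z.1 /\ (0 <= z.2 < side Q)%R].

Definition average Q (g : Rn -> R) : \bar R :=
  (leb Q)^-1 * \int[leb]_(y in Q) `|g y|%:E.

Definition maximal f (z : Rn * measurableTypeR R) : \bar R :=
  ereal_sup [set \prod_(i < m) average Q (f i) |
    Q in [set Q : cube R n | cube_set Q z.1 /\ (z.2 <= side Q)%R]].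

(* Local integrability is integrability on cubes: every compact set lies in a
   cube, and cubes are compact. *)
Definition weight (v : Rn -> R) : Prop :=
  [/\ measurable_fun setT v, (forall x, (0 <= v x)%R) &
      forall Q, leb.-integrable Q (EFin \o v)].

(* For q > 1 the exponent 1 - q' is negative, whereas [powR] has
   0 `^ r = 0 for r != 0: only meaningful where v > 0. *)
Definition dual_weight q (v : Rn -> R) (x : Rn) : R :=
  (v x `^ (1 - q / (q - 1)))%R.

Definition wnorm q (v g : Rn -> R) : \bar R :=
  (\int[leb]_x (`|g x| `^ q * v x)%:E) `^ q^-1.

Definition in_weighted_Lp q (v g : Rn -> R) : Prop :=
  measurable_fun setT g /\ wnorm q v g < +oo.

Definition half_space_norm (mu : {measure set (Rn * measurableTypeR R) -> \bar R})
    p (F : Rn * measurableTypeR R -> \bar R) : \bar R :=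
  (\int[mu]_(z in half_space) F z `^ p) `^ p^-1.

Definition reverse_hoelder_bound ps p w (C : R) : Prop :=
  forall Q,
    \prod_(i < m) (\int[leb]_(x in Q) (dual_weight (ps i) (w i) x)%:E)
                    `^ (p / ps i)
    <= C%:E * \int[leb]_(x in Q)
         (\prod_(i < m) (dual_weight (ps i) (w i) x) `^ (p / ps i))%R%:E.

Definition reverse_hoelder ps p w : Prop :=
  exists C : R, reverse_hoelder_bound ps p w C.

Definition reverse_hoelder_constant ps p w (C : R) : Prop :=
  reverse_hoelder_bound ps p w C /\
  forall C', reverse_hoelder_bound ps p w C' -> (C <= C')%R.

Section conditions.
Variable mu : {measure set (Rn * measurableTypeR R) -> \bar R}.

Definition bounded_by ps p w (C : R) : Prop :=
  forall f, (forall i, in_weighted_Lp (ps i) (w i) (f i)) ->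
    half_space_norm mu p (maximal f) <=
      C%:E * \prod_(i < m) wnorm (ps i) (w i) (f i).

Definition dual_bounded_by ps p w (C : R) : Prop :=
  forall f, (forall i, in_weighted_Lp (ps i) (dual_weight (ps i) (w i)) (f i)) ->
    half_space_norm mu p
      (maximal (fun i x => (f i x * dual_weight (ps i) (w i) x)%R)) <=
      C%:E * \prod_(i < m) wnorm (ps i) (dual_weight (ps i) (w i)) (f i).

Definition smallest_constant (P : R -> Prop) : \bar R :=
  ereal_inf [set C%:E | C in [set C : R | (0 < C)%R /\ P C]].

Definition operator_norm ps p w : \bar R :=
  smallest_constant (bounded_by ps p w).

Definition dual_operator_norm ps p w : \bar R :=
  smallest_constant (dual_bounded_by ps p w).

(* Quotient with +oo / +oo = +oo; the library has +oo * (+oo)^-1 = 0, which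
   would make the testing condition void on the cubes where some dual weight
   is not integrable. *)
Definition equotient (x y : \bar R) : \bar R :=
  if x == +oo then +oo else x * y^-1.

Definition testing_constant ps p w : \bar R :=
  ereal_sup [set
    equotient
      ((\int[mu]_(z in tent Q)
          maximal (fun i x => (dual_weight (ps i) (w i) x * \1_Q x)%R) z `^ p)
        `^ p^-1)
      (\prod_(i < m) (\int[leb]_(x in Q) (dual_weight (ps i) (w i) x)%:E)
                       `^ (ps i)^-1)
    | Q in [set: cube R n]].

Definition testing_condition ps p w : Prop := testing_constant ps p w < +oo.

End conditions.
End MultilinearMaximal.

(* Main.v *)
(**
  Statements (1) and (2) are the same statement: [f] and [g = f / sigma] have
  equal norms in [L^q(w)] and [L^q(sigma)], because [sigma^q w = sigma].
  Testing (2) on indicator functions of a cube [Q] gives (3); if some [sigma_i]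
  has infinite mass on [Q], truncating it shows that the tent over [Q] is null.

  For (3) => (2), the maximal operator is dominated by finitely many dyadic
  ones, since every cube lies in a comparable cube of one of [2^n] shifted
  grids. For a finite family of cubes of one grid, let [E_R] be the set of
  points where the maximum is attained at [R]. The integral of the [p]-th power
  of the maximal function is then the sum over [R] of
    [mu(E_R) (prod_i sigma_i(R) / |R|)^p * (prod_i <f_i>_R)^p],
  where [<f_i>_R] is the mean of [f_i] on [R] with respect to [sigma_i].
  The testing and reverse Hoelder conditions say that the first factors form a
  Carleson sequence with respect to [nu = prod_i sigma_i^(p/p_i)], so the sum
  is controlled by the [nu]-integral of [sup_R (prod_i <f_i>_R)^p]; Hoelder's
  inequality splits it into dyadic maximal functions with respect to the
  measures [sigma_i], each of which is bounded by Doob's inequality.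
*)
Require Import Defs.
From mathcomp Require Import all_boot all_order all_algebra.
From mathcomp Require Import all_classical all_reals all_analysis.
From mathcomp Require Import measurable_realfun.
From mathcomp Require Import ring lra.

Set Implicit Arguments.
Unset Strict Implicit.
Unset Printing Implicit Defensive.

Import Order.TTheory GRing.Theory Num.Theory.
Import numFieldNormedType.Exports.

Local Open Scope classical_set_scope.
Local Open Scope ring_scope.

(** * Integrals of nonnegative functions and powers of extended reals *)

Section Integral.
Context d (T : measurableType d) (R : realType).
Variable mu : {measure set T -> \bar R}.
Local Open Scope ereal_scope.

(* No measurability is needed: the integral of a nonnegative function is the
   supremum of the integrals of the simple functions below it. *)
Lemma ge0_le_integral_nonmeasurable (A B : set T) (f g : T -> \bar R) :
  (forall x, A x -> 0 <= f x) -> (forall x, B x -> 0 <= g x) ->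
  (forall x, A x -> B x /\ f x <= g x) ->
  \int[mu]_(x in A) f x <= \int[mu]_(x in B) g x.
Proof.
move=> f0 g0 fg; rewrite !ge0_integralE//; apply: le_ereal_sup => _ [h hf <-].
exists h => // x; apply: le_trans (hf x) _; rewrite !patchE.
have [xA|xA] := boolP (x \in A).
  by have [Bx fgx] := fg _ (set_mem xA); rewrite mem_set.
by case: ifPn => // xB; apply: g0; exact: set_mem.
Qed.

Lemma poweR_le (x y : \bar R) (r : R) : (0 <= r)%R -> 0 <= x -> x <= y -> x `^ r <= y `^ r.
Proof.
move=> r0 x0 xy; apply: gt0_ler_poweR => //; rewrite in_itv/= leey andbT//.
exact: le_trans xy.
Qed.

Lemma poweRK (x : \bar R) (r : R) : (0 < r)%R -> 0 <= x -> (x `^ r) `^ r^-1 = x.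
Proof. by move=> r0 x0; rewrite -poweRrM divff ?gt_eqF// poweRe1. Qed.

Lemma poweRVK (x : \bar R) (r : R) : (0 < r)%R -> 0 <= x -> (x `^ r^-1) `^ r = x.
Proof. by move=> r0 x0; rewrite -poweRrM mulVf ?gt_eqF// poweRe1. Qed.

End Integral.

(** * Telescoping sums over finitely many values *)

Section Layers.
Context {R : realType}.

(** [P] lists the pairs of consecutive entries of [v :: s], so the sum telescopes. It is chosen
    before [phi], which lets different powers of one function be compared layer by layer. *)
Lemma layers_path (v : R) (s : seq R) : path <%R v s ->
  exists P : seq (R * R),
    (forall ab, ab \in P -> v <= ab.1 < ab.2) /\
    forall (phi : R -> R) x, x \in v :: s ->
      phi x = phi v + \sum_(ab <- P) (phi ab.2 - phi ab.1) * (ab.2 <= x)%R%:R.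
Proof.
elim: s v => [v _|u s IH v /= /andP[vu us]].
  by exists [::]; split=> // phi x; rewrite inE => /eqP ->; rewrite big_nil addr0.
have [P [P0 PE]] := IH _ us; exists ((v, u) :: P); split.
  move=> ab; rewrite inE => /predU1P[->/=|/P0/andP[uab ->]]; first by rewrite lexx.
  by rewrite andbT (le_trans (ltW vu)).
move=> phi x; rewrite inE big_cons/= => /predU1P[->|xs].
  rewrite leNgt vu mulr0 add0r big_seq big1 ?addr0// => ab /P0/andP[uab ab12].
  by rewrite leNgt (lt_trans vu (le_lt_trans uab ab12)) mulr0.
have ux : u <= x.
  move: xs; rewrite inE => /predU1P[->//|xs].
  by apply: ltW; move/order_path_min: us => /(_ lt_trans)/allP; exact.
by rewrite (PE phi x xs) ux mulr1 addrA addrCA subrr addr0.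
Qed.

Lemma layers (s : seq R) : exists P : seq (R * R),
  (forall ab, ab \in P -> 0 <= ab.1 < ab.2) /\
  forall (phi : R -> R) x, 0 <= x -> x \in 0 :: s -> phi 0 = 0 ->
    phi x = \sum_(ab <- P) (phi ab.2 - phi ab.1) * (ab.2 <= x)%R%:R.
Proof.
pose s' := sort <=%R (undup [seq x <- s | 0 < x]).
have [|P [P0 PE]] := @layers_path 0 s'.
  rewrite (@path_sortedE _ _ lt_trans); apply/andP; split.
    by apply/allP => x; rewrite mem_sort mem_undup mem_filter => /andP[].
  by rewrite lt_sorted_uniq_le sort_uniq undup_uniq/= sort_le_sorted.
exists P; split=> // phi x x0 xs phi0; rewrite (PE phi x) ?phi0 ?add0r//.
move: x0; rewrite le_eqVlt => /predU1P[<-|x0]; first by rewrite mem_head.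
rewrite inE mem_sort mem_undup mem_filter x0/=.
by move: xs; rewrite inE gt_eqF//= => ->; rewrite orbT.
Qed.

End Layers.

(** * Maximal members of a finite laminar family *)

Section Antichain.
Context {R : realType} {X : Type} {T : eqType}.
Variables (D : T -> set X) (rk : T -> R).
Hypothesis laminar : forall r s, rk r <= rk s -> D r `<=` D s \/ D r `&` D s = set0.

(** Induction over the family sorted by increasing rank: the head has the smallest rank, so by
    laminarity it either lies in a member already selected or is disjoint from all of them, and then
    it is added. *)
Lemma maximal_antichain (F : seq T) : uniq F ->
  exists G : seq T, [/\ uniq G, {subset G <= F},
    (forall r, r \in F -> exists2 s, s \in G & D r `<=` D s) &
    trivIset [set` G] D].
Proof.
move=> uF.
suff H (F' : seq T) : uniq F' -> sorted (fun r s => rk r <= rk s) F' ->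
  exists G : seq T, [/\ uniq G, {subset G <= F'},
    (forall r, r \in F' -> exists2 s, s \in G & D r `<=` D s) &
    trivIset [set` G] D].
  have tot : total (fun r s => rk r <= rk s) by move=> r s; exact: le_total.
  have [||G [uG GF FG tG]] := H (sort (fun r s => rk r <= rk s) F).
  - by rewrite sort_uniq.
  - exact: sort_sorted.
  exists G; split=> //; first by move=> r /GF; rewrite mem_sort.
  by move=> r rF; apply: FG; rewrite mem_sort.
elim: F' => [_ _|r F' IH /= /andP[rF' uF'] pF'].
  by exists [::]; split=> //; apply/trivIsetP.
have [|G [uG GF FG tG]] := IH uF'; first exact: path_sorted pF'.
have rkF s : s \in F' -> rk r <= rk s.
  have tr : transitive (fun r s => rk r <= rk s) by move=> ? ? ?; exact: le_trans.
  by move: s; apply/allP; exact: order_path_min pF'.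
have [[s sG rs]|nG] := pselect (exists2 s, s \in G & D r `<=` D s).
  exists G; split=> //; first by move=> t /GF; rewrite inE orbC => ->.
  by move=> t; rewrite inE => /predU1P[->|/FG//]; exists s.
exists (r :: G); split=> /=.
- by rewrite uG andbT; apply: contra rF'; exact: GF.
- by move=> t; rewrite !inE => /predU1P[->|/GF ->]; rewrite ?eqxx ?orbT.
- move=> t; rewrite inE => /predU1P[->|/FG[s sG ts]].
    by exists r; rewrite ?mem_head.
  by exists s => //; rewrite inE sG orbT.
have rG s : s \in G -> D r `&` D s = set0.
  move=> sG; have [rs|//] := laminar (rkF _ (GF _ sG)).
  by exfalso; apply: nG; exists s.
apply/trivIsetP => s t /=; rewrite !inE => /predU1P[->|sG] /predU1P[->|tG'] st.
- by rewrite eqxx in st.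
- exact: rG.
- by rewrite setIC; exact: rG.
- by move/trivIsetP : tG; apply.
Qed.

End Antichain.

(** * Weighted maxima of finitely many indicator functions *)

Lemma maxr_in {R : realDomainType} (s : seq R) (x y : R) :
  x \in s -> y \in s -> Num.max x y \in s.
Proof. by rewrite maxEle; case: ifP. Qed.

(** With averages for [l] this is a maximal function restricted to the family [F]. The default 0 is
    its value off all the sets [D r], hence the restriction to positive levels [b] below. *)
Definition maxover {R : realType} {X : Type} {T : Type} (F : seq T) (D : T -> set X)
  (l : T -> R) (x : X) : R := \big[Num.max/0]_(r <- F) (l r * \1_(D r) x).

Section MaxOver.
Context {R : realType} {X : Type} {T : eqType}.
Variables (F : seq T) (D : T -> set X) (l : T -> R).
Local Notation M := (maxover F D l).

Lemma maxover_ge0 x : 0 <= M x.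
Proof.
rewrite /maxover; elim: F => [|r F' IH]; first by rewrite big_nil.
by rewrite big_cons le_max IH orbT.
Qed.

Lemma maxover_geP (b : R) x : 0 < b ->
  b <= M x <-> exists r, [/\ r \in F, D r x & b <= l r].
Proof.
move=> b0; rewrite /maxover; elim: F => [|r F' IH].
  by rewrite big_nil leNgt b0; split=> // -[r []].
rewrite big_cons le_max; split.
  case/orP=> [|/IH[s [sF Ds bs]]]; last by exists s; split=> //; rewrite inE sF orbT.
  rewrite indicE; have [xD|_] := boolP (x \in D r); last by rewrite mulr0 leNgt b0.
  by rewrite mulr1 => br; exists r; split; rewrite ?mem_head//; exact: set_mem.
move=> [s []]; rewrite inE => /predU1P[->|sF] Ds bs.
  by rewrite indicE mem_set// mulr1 bs.
by apply/orP; right; apply/IH; exists s.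
Qed.

Lemma maxover_in x : M x \in 0 :: [seq l r | r <- F].
Proof.
rewrite /maxover; elim: F => [|r F' IH]; first by rewrite big_nil mem_head.
rewrite big_cons /=; apply: maxr_in.
  rewrite indicE; case: (x \in D r); rewrite ?mulr1 ?mulr0 ?mem_head//.
  by rewrite !inE eqxx orbT.
by move: IH; rewrite !inE => /orP[->//|->]; rewrite !orbT.
Qed.

End MaxOver.

Lemma maxover_subset {R : realType} {X : Type} {T : eqType} (F F' : seq T) (D : T -> set X)
    (l : T -> R) (x : X) : {subset F <= F'} -> maxover F D l x <= maxover F' D l x.
Proof.
move=> FF'; have [/le_trans|M0] := leP (maxover F D l x) 0; first by apply; exact: maxover_ge0.
have [/(_ (lexx _))[r [rF Dr lr]] _] := maxover_geP F D l x M0.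
by apply/(maxover_geP F' D l x M0); exists r; split=> //; exact: FF'.
Qed.

Lemma measurable_maxover {R : realType} d (X : measurableType d) {T : Type} (F : seq T)
    (D : T -> set X) (l : T -> R) (E : set X) :
  (forall r, measurable (D r)) -> measurable_fun E (maxover F D l).
Proof.
move=> mD; rewrite /maxover; elim: F => [|r F IH].
  by under eq_fun do rewrite big_nil; exact: measurable_cst.
under eq_fun do rewrite big_cons.
by apply: measurable_maxr => //; exact: measurable_funM.
Qed.

Lemma integral_natrM {R : realType} d (X : measurableType d)
    (mu : {measure set X -> \bar R}) (P : X -> bool) (h : X -> R) :
  (\int[mu]_x ((P x)%:R * h x)%:E = \int[mu]_(x in [set x | P x]) (h x)%:E)%E.
Proof.
rewrite [RHS]integral_mkcond; apply: eq_integral => x _; rewrite patchE.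
have [Px|Px] := boolP (P x); first by rewrite mem_set//= mul1r.
by rewrite memNset ?mul0r//=; exact/negP.
Qed.

(** * Dyadic maximal functions of finite families of cubes *)

Section LayerCake.
Context {R : realType} d (X : measurableType d) {T : choiceType}.
Variables (mu : {measure set X -> \bar R}) (F : seq T) (D : T -> set X) (rk : T -> R).
Hypothesis mD : forall r, measurable (D r).
Hypothesis laminar : forall r s, rk r <= rk s -> D r `<=` D s \/ D r `&` D s = set0.
Hypothesis uF : uniq F.
Variable l : T -> R.
Hypothesis l0 : forall r, 0 <= l r.
Local Notation M := (maxover F D l).
Local Notation U b := [set x | (b <= M x)%R].

Lemma measurable_level b : measurable (U b).
Proof.
rewrite (_ : U b = M @^-1` `[b, +oo[); last first.
  by apply/seteqP; split=> x /=; rewrite in_itv/= andbT.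
by rewrite -[X in measurable X]setTI; apply: measurable_maxover.
Qed.

(** A positive level set of [M] is the union of the [D r] with [b <= l r]; the maximal ones among
    these are disjoint, so integrals over the level set split along [G]. *)
Lemma level_antichain b : 0 < b -> exists G : seq T,
  [/\ uniq G, {subset G <= F}, forall s, s \in G -> b <= l s,
   (forall r, r \in F -> b <= l r -> exists2 s, s \in G & D r `<=` D s) &
   forall h : X -> R, measurable_fun setT h -> (forall x, 0 <= h x) ->
    (\int[mu]_(x in U b) (h x)%:E = \sum_(s <- G) \int[mu]_(x in D s) (h x)%:E)%E].
Proof.
move=> b0; have [|G [uG GF FG tG]] := maximal_antichain laminar (F := [seq r <- F | b <= l r]).
  exact: filter_uniq.
exists G; split=> //.
- by move=> r /GF; rewrite mem_filter => /andP[].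
- by move=> r /GF; rewrite mem_filter => /andP[].
- by move=> r rF br; apply: FG; rewrite mem_filter br.
move=> h mh h0; have -> : U b = \big[setU/set0]_(s <- G) D s.
  rewrite -bigcup_seq; apply/seteqP; split=> x /=.
    move=> /(maxover_geP _ _ _ _ b0)[r [rF Dr br]].
    have [|s sG rs] := FG r; first by rewrite mem_filter br.
    by exists s => //; exact: rs.
  move=> [s /= sG Ds]; apply/(maxover_geP _ _ _ _ b0); exists s; split=> //.
    by have := GF _ sG; rewrite mem_filter => /andP[].
  by have := GF _ sG; rewrite mem_filter => /andP[].
rewrite ge0_integral_bigsetU//.
- by apply: measurable_funTS; apply/measurable_EFinP.
- by move=> x _; rewrite lee_fin.
Qed.

(** [M] takes its values in [0 :: [seq l r | r <- F]], whose consecutive values, once sorted, form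
    the pairs of [P]. One list serves all [phi] and [h], and also decomposes the numbers [l r]
    themselves. *)
Lemma layer_cake : exists P : seq (R * R),
  [/\ forall ab, ab \in P -> 0 <= ab.1 < ab.2,
  (forall (phi : R -> R) (h : X -> R), phi 0 = 0 ->
    (forall a b, 0 <= a -> a <= b -> phi a <= phi b) ->
    measurable_fun setT h -> (forall x, 0 <= h x) ->
    (\int[mu]_x (phi (M x) * h x)%:E =
     \sum_(ab <- P) (phi ab.2 - phi ab.1)%:E * \int[mu]_(x in U ab.2) (h x)%:E)%E) &
  forall r, r \in F -> l r = \sum_(ab <- P) (ab.2 - ab.1) * (ab.2 <= l r)%R%:R].
Proof.
have [P [P0 PE]] := layers [seq l r | r <- F]; exists P; split=> //; last first.
  by move=> r rF; apply: (PE id) => //; rewrite inE map_f ?orbT.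
move=> phi h phi0 phile mh h0.
under eq_integral do rewrite (PE phi _ (maxover_ge0 _ _ _ _) (maxover_in _ _ _ _) phi0)
  mulr_suml -sumEFin big_seq.
have dphi ab : ab \in P -> 0 <= phi ab.2 - phi ab.1.
  by move=> /P0/andP[a0 ab12]; rewrite subr_ge0; apply: phile => //; exact: ltW.
(* Extending the coefficients by 0 makes them nonnegative at every pair, as exchanging the sum and
   the integral requires. *)
pose c ab := if ab \in P then phi ab.2 - phi ab.1 else 0.
have c0 ab : 0 <= c ab by rewrite /c; case: ifPn => // /dphi.
rewrite (eq_integral (fun x => \sum_(ab <- P)
    (c ab)%:E * ((ab.2 <= M x)%R%:R * h x)%:E)%E); last first.
  move=> x _; rewrite [RHS]big_seq; apply: eq_bigr => ab abP.
  by rewrite /c abP -EFinM mulrA.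
have mb (b : R) : measurable_fun setT (fun x : X => ((b <= M x)%R%:R * h x)%:E).
  apply/measurable_EFinP/measurable_funM => //.
  rewrite (_ : (fun x => _) = \1_(U b)); first exact/measurable_indic/measurable_level.
  apply/funext => x; rewrite indicE; congr (_%:R); congr nat_of_bool.
  by apply/idP/idP => [?|/set_mem//]; exact: mem_set.
rewrite ge0_integral_sum//; last 2 first.
- by move=> ab; apply: measurable_funeM.
- by move=> ab x _; rewrite -EFinM lee_fin !mulr_ge0.
rewrite big_seq [RHS]big_seq; apply: eq_bigr => ab abP.
rewrite ge0_integralZl_EFin//; last by move=> x _; rewrite lee_fin mulr_ge0.
by rewrite integral_natrM /c abP.
Qed.

(** Carleson's embedding. Both sides are cut into the same layers; the [r] with [l r] above a level
    are all contained in members of the antichain of that level, and the packing bounds under these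
    members add up to the integral over the level set. *)
Lemma carleson (a : T -> \bar R) (A : R) (h : X -> R) :
  (forall r, 0 <= a r)%E -> 0 <= A ->
  measurable_fun setT h -> (forall x, 0 <= h x) ->
  (forall s, s \in F -> \sum_(r <- F | `[< D r `<=` D s >]) a r <=
     A%:E * \int[mu]_(x in D s) (h x)%:E)%E ->
  (\sum_(r <- F) a r * (l r)%:E <= A%:E * \int[mu]_x (M x * h x)%:E)%E.
Proof.
move=> a0 A0 mh h0 pack; have [P [P0 PE lE]] := layer_cake.
rewrite (PE id h)//.
have dP ab : ab \in P -> (0 <= ab.2 - ab.1)%R by move=> /P0/andP[_ ?]; rewrite subr_ge0 ltW.
rewrite big_seq (eq_bigr (fun r => \sum_(ab <- P)
    (ab.2 - ab.1)%:E * (a r * (ab.2 <= l r)%R%:R%:E))%E); last first.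
  move=> r rF; rewrite {1}(lE _ rF) -sumEFin big_seq ge0_sume_distrr; last first.
    by move=> ab /dP ab12; rewrite lee_fin mulr_ge0.
  by rewrite [RHS]big_seq; apply: eq_bigr => ab _; rewrite EFinM muleCA.
rewrite -big_seq exchange_big/= [leLHS]big_seq [X in (_ * X)%E]big_seq ge0_sume_distrr; last first.
  move=> ab abP; rewrite mule_ge0 ?lee_fin ?dP//.
  by apply: integral_ge0 => x _; rewrite lee_fin.
apply: lee_sum => ab abP; rewrite muleCA -ge0_sume_distrr; last first.
  by move=> r _; rewrite mule_ge0.
apply: lee_wpmul2l; first by rewrite lee_fin dP.
have b0 : (0 < ab.2)%R by have /andP[+ +] := P0 _ abP; exact: le_lt_trans.
have [G [uG GF Gb FG GE]] := level_antichain b0; rewrite GE//.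
rewrite ge0_sume_distrr; last first.
  by move=> s _; apply: integral_ge0 => x _; rewrite lee_fin.
apply: (@le_trans _ _ (\sum_(s <- G) \sum_(r <- F | `[< D r `<=` D s >]) a r)%E); last first.
  by rewrite big_seq [leRHS]big_seq; apply: lee_sum => s /GF; exact: pack.
under [leRHS]eq_bigr do rewrite big_mkcond.
rewrite exchange_big/= big_seq [leRHS]big_seq; apply: lee_sum => r rF.
have [br|_] := boolP (ab.2 <= l r)%R; last first.
  by rewrite mule0; apply: sume_ge0 => s _; case: ifP.
have [s sG rs] := FG _ rF br.
rewrite mule1 (bigD1_seq s)//= asboolT//; apply: leeDl.
by apply: sume_ge0 => t _; case: ifP.
Qed.

End LayerCake.

(** * Doob's maximal inequality for a finite laminar family *)

Section Doob.
Context {R : realType}.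

(** Young's inequality for b a^(q-1), with conjugate exponents [q] and [q / (q - 1)]. A layer of M^q
    is thereby bounded by a layer of M^(q-1) times its upper height [b], the factor which the weak
    type estimate takes up. *)
Lemma powR_increment_le (q a b : R) : 1 < q -> 0 <= a -> a <= b ->
  b `^ q - a `^ q <= q / (q - 1) * (b * (b `^ (q - 1) - a `^ (q - 1))).
Proof.
move=> q1 a0 ab; have b0 := le_trans a0 ab.
have q0 : 0 < q by lra.
have q10 : 0 < q - 1 by lra.
have := @conjugate_powR R b (a `^ (q - 1)) q (q / (q - 1)) b0 (powR_ge0 _ _) q0.
rewrite divr_gt0// -powRrM mulrCA mulfV ?gt_eqF// mulr1 => /(_ isT) H.
rewrite mulrBr mulr_powRB1//.
have {}H : b * a `^ (q - 1) <= b `^ q / q + a `^ q / (q / (q - 1)).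
  by apply: H; field; rewrite !gt_eqF.
rewrite -(ler_pM2l (divr_gt0 q0 q10)) in H.
have -> : q / (q - 1) * (b `^ q - b * a `^ (q - 1)) =
  q / (q - 1) * b `^ q - q / (q - 1) * (b * a `^ (q - 1)) by ring.
have E : q / (q - 1) * (b `^ q / q + a `^ q / (q / (q - 1))) =
  q / (q - 1) * b `^ q - b `^ q + a `^ q by field; rewrite !gt_eqF.
rewrite E in H; lra.
Qed.

(** This is (2q')^q with q' = q / (q - 1). The classical constant is q'^q; the factor 2^q pays for
    the absorption of M^q. *)
Definition doob_const (q : R) : R :=
  2 * (q / (q - 1) * (2 * (q / (q - 1))) `^ (q - 1)).

Lemma doob_const_gt0 (q : R) : 1 < q -> 0 < doob_const q.
Proof.
move=> q1; have q10 : 0 < q / (q - 1) by rewrite divr_gt0//; lra.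
by apply: mulr_gt0 => //; apply: mulr_gt0 => //; apply: powR_gt0; exact: mulr_gt0.
Qed.

(** [M] is compared with 2cf, where c = q / (q - 1): below it, [M] is replaced by 2cf, which gives
    the term in f^q; above it, cf is at most M/2, which gives half of M^q. *)
Lemma powR_absorb (q f M : R) : 1 < q -> 0 <= f -> 0 <= M ->
  q / (q - 1) * (f * M `^ (q - 1)) <= 2^-1 * doob_const q * f `^ q + 2^-1 * M `^ q.
Proof.
move=> q1 f0 M0; set c := q / (q - 1).
have c0 : 0 < c by rewrite divr_gt0//; lra.
have q0 : 0 < q by lra.
rewrite /doob_const mulKf ?pnatr_eq0// -/c.
have cf0 : 0 <= 2 * c * f by rewrite mulr_ge0// mulr_ge0// ltW.
have [Mf|fM] := leP M (2 * c * f).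
  apply: (@le_trans _ _ (c * (f * (2 * c * f) `^ (q - 1)))).
    rewrite ler_pM2l// ler_wpM2l// ge0_ler_powR ?nnegrE//.
    by rewrite subr_ge0 ltW.
  rewrite powRM//; last by rewrite mulr_ge0// ltW.
  have -> : c * (f * ((2 * c) `^ (q - 1) * f `^ (q - 1))) =
    c * (2 * c) `^ (q - 1) * (f * f `^ (q - 1)) by ring.
  by rewrite mulr_powRB1// lerDl mulr_ge0// ?powR_ge0.
have -> : c * (f * M `^ (q - 1)) = 2^-1 * (2 * c * f * M `^ (q - 1)) by field.
apply: (@le_trans _ _ (2^-1 * M `^ q)).
  rewrite ler_pM2l ?invr_gt0// -(@mulr_powRB1 _ M q)//.
  by rewrite ler_wpM2r ?powR_ge0// ltW.
by rewrite lerDr mulr_ge0 ?powR_ge0// mulr_ge0 ?powR_ge0// ltW.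
Qed.

Context d (X : measurableType d) {T : choiceType}.
Variables (mu : {measure set X -> \bar R}) (F : seq T) (D : T -> set X) (rk : T -> R).
Hypothesis mD : forall r, measurable (D r).
Hypothesis laminar : forall r s, rk r <= rk s -> D r `<=` D s \/ D r `&` D s = set0.
Hypothesis uF : uniq F.
Variable l : T -> R.
Hypothesis l0 : forall r, 0 <= l r.
Local Notation M := (maxover F D l).

(* Doob's maximal inequality: the layers of M^q and M^(q-1) are compared through
   the weak type estimate on each level set, and M^q is then absorbed. *)
Lemma doob (q : R) (f s : X -> R) : 1 < q ->
  measurable_fun setT f -> (forall x, 0 <= f x) ->
  measurable_fun setT s -> (forall x, 0 <= s x) ->
  (forall r, r \in F -> \int[mu]_(x in D r) (s x)%:E < +oo)%E ->
  (forall r, r \in F -> (l r)%:E * \int[mu]_(x in D r) (s x)%:E <=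
                        \int[mu]_(x in D r) (f x * s x)%:E)%E ->
  (\int[mu]_x (M x `^ q * s x)%:E <=
   (doob_const q)%:E * \int[mu]_x (f x `^ q * s x)%:E)%E.
Proof.
move=> q1 mf f0 ms s0 sfin weak.
have q0 : 0 < q by lra.
have q10 : 0 < q - 1 by lra.
have [P [P0 PE _]] := layer_cake mu F mD l0.
have mfs : measurable_fun setT (fun x => f x * s x) by exact: measurable_funM.
have fs0 x : 0 <= f x * s x by rewrite mulr_ge0.
have mM : measurable_fun setT M by exact: measurable_maxover.
have mpow r g : measurable_fun setT g -> measurable_fun setT (fun x : X => g x `^ r).
  by move=> mg; apply: (measurableT_comp (measurable_powR r)).
have powle r (a b : R) : 0 <= r -> 0 <= a -> a <= b -> a `^ r <= b `^ r.
  by move=> r0 a0 ab; rewrite ge0_ler_powR// nnegrE (le_trans a0 ab).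
have pow0 r : 0 < r -> 0 `^ r = 0 :> R by move=> r0; rewrite powR0// gt_eqF.
have PEq := PE (fun v => v `^ q) s (pow0 _ q0)
  (fun a b => powle q a b (ltW q0)) ms s0.
have PEq1 := PE (fun v => v `^ (q - 1)) _ (pow0 _ q10)
  (fun a b => powle (q - 1) a b (ltW q10)) mfs fs0.
have Ufin b : 0 < b -> (\int[mu]_(x in [set x | (b <= M x)%R]) (s x)%:E < +oo)%E.
  move=> b0; have [G [_ GF _ _ ->//]] := level_antichain mu mD laminar uF l b0.
  by rewrite big_seq; apply: lte_sum_pinfty => r /GF; exact: sfin.
have Uweak b : 0 < b -> (b%:E * \int[mu]_(x in [set x | (b <= M x)%R]) (s x)%:E <=
    \int[mu]_(x in [set x | (b <= M x)%R]) (f x * s x)%:E)%E.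
  move=> b0; have [G [_ GF Gb _ GE]] := level_antichain mu mD laminar uF l b0.
  rewrite !GE// ge0_sume_distrr; last first.
    by move=> r _; apply: integral_ge0 => x _; rewrite lee_fin.
  rewrite big_seq [leRHS]big_seq; apply: lee_sum => r rG.
  apply: le_trans (weak r (GF _ rG)); apply: lee_wpmul2r; last by rewrite lee_fin Gb.
  by apply: integral_ge0 => x _; rewrite lee_fin.
have int0 (U : set X) (h : X -> R) : (forall x, 0 <= h x) ->
    (0 <= \int[mu]_(x in U) (h x)%:E)%E.
  by move=> h0; apply: integral_ge0 => x _; rewrite lee_fin.
set I := (\int[mu]_x (M x `^ q * s x)%:E)%E.
have I0 : (0 <= I)%E by apply: int0 => x; rewrite mulr_ge0// powR_ge0.
(* Finiteness of [I] is what allows half of it to be absorbed at the end; there are finitely many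
   layers, each carried by a level set of finite mass. *)
have Ifin : (I < +oo)%E.
  rewrite /I PEq big_seq; apply: lte_sum_pinfty => ab abP.
  have /andP[a0 ab12] := P0 _ abP.
  apply: lte_mul_pinfty; rewrite ?lee_fin ?subr_ge0 ?powle// 1?ltW//.
  by apply: Ufin; exact: le_lt_trans ab12.
have I1 : (I <= (q / (q - 1))%:E * \int[mu]_x (M x `^ (q - 1) * (f x * s x))%:E)%E.
  rewrite /I PEq PEq1 big_seq [X in (_ * X)%E]big_seq ge0_sume_distrr; last first.
    move=> ab abP; have /andP[a0 ab12] := P0 _ abP.
    by rewrite mule_ge0 ?int0// lee_fin subr_ge0 powle// ltW.
  apply: lee_sum => ab abP; have /andP[a0 ab12] := P0 _ abP.
  have b0 : 0 < ab.2 by exact: le_lt_trans ab12.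
  apply: (@le_trans _ _ ((q / (q - 1) * (ab.2 * (ab.2 `^ (q - 1) - ab.1 `^ (q - 1))))%:E *
      \int[mu]_(x in [set x | (ab.2 <= M x)%R]) (s x)%:E)%E).
    by apply: lee_wpmul2r; [exact: int0|rewrite lee_fin powR_increment_le// ltW].
  rewrite (EFinM (q / (q - 1))) (mulrC ab.2) (EFinM _ ab.2) -!muleA; apply: lee_wpmul2l.
    by rewrite lee_fin divr_ge0// ltW.
  apply: lee_wpmul2l; last exact: Uweak.
  by rewrite lee_fin subr_ge0 powle// ltW.
set J := (\int[mu]_x (f x `^ q * s x)%:E)%E.
have I2 : (I <= (2^-1 * doob_const q)%:E * J + 2^-1%:E * I)%E.
  apply: (le_trans I1).
  have dc0 : 0 <= 2^-1 * doob_const q by rewrite mulr_ge0// ltW// doob_const_gt0.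
  have m1 : measurable_fun setT (fun x => (f x `^ q * s x)%:E).
    by apply/measurable_EFinP/measurable_funM => //; exact: mpow.
  have m2 : measurable_fun setT (fun x => (M x `^ q * s x)%:E).
    by apply/measurable_EFinP/measurable_funM => //; exact: mpow.
  have m3 : measurable_fun setT (fun x => (M x `^ (q - 1) * (f x * s x))%:E).
    by apply/measurable_EFinP/measurable_funM => //; exact: mpow.
  have c0 : 0 <= q / (q - 1) by rewrite divr_ge0// ltW.
  have pull (k : R) g : 0 <= k -> (forall x, 0 <= g x) ->
      measurable_fun setT (fun x : X => (g x)%:E) ->
      (k%:E * \int[mu]_x (g x)%:E = \int[mu]_x (k%:E * (g x)%:E))%E.
    by move=> k0 g0 mg; rewrite ge0_integralZl_EFin// => x _; rewrite lee_fin.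
  rewrite /I /J !pull//; try by move=> x; rewrite !mulr_ge0 ?powR_ge0.
  rewrite -ge0_integralD//; first last.
  - exact: measurable_funeM.
  - by move=> x _; rewrite -EFinM lee_fin !mulr_ge0 ?powR_ge0.
  - exact: measurable_funeM.
  - by move=> x _; rewrite -EFinM lee_fin mulr_ge0// mulr_ge0 ?powR_ge0.
  apply: ge0_le_integral_nonmeasurable => x _.
  - by rewrite -EFinM lee_fin mulr_ge0// mulr_ge0 ?powR_ge0.
  - by rewrite -!EFinM -EFinD lee_fin addr_ge0// mulr_ge0// mulr_ge0 ?powR_ge0.
  split=> //; rewrite -!EFinM -EFinD lee_fin.
  have := ler_wpM2r (s0 x) (powR_absorb q1 (f0 x) (maxover_ge0 F D l x)).
  by congr (_ <= _); ring.
have [Joo|Jfin] := leP +oo%E J.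
  move: Joo; rewrite leye_eq => /eqP ->.
  by rewrite gt0_muley ?leey// lte_fin doob_const_gt0.
have J0 : (0 <= J)%E by apply: int0 => x; rewrite mulr_ge0// powR_ge0.
move: I2; rewrite -(fineK (_ : I \is a fin_num)) ?ge0_fin_numE//.
rewrite -(fineK (_ : J \is a fin_num)) ?ge0_fin_numE//.
rewrite -!EFinM -EFinD !lee_fin; lra.
Qed.
End Doob.

(** * Products of real powers *)

Section PowerProducts.
Context {R : realType}.

Lemma powR_prod (I : Type) (s : seq I) (P : pred I) (x : I -> R) (r : R) :
  (forall i, P i -> 0 <= x i) ->
  (\prod_(i <- s | P i) x i) `^ r = \prod_(i <- s | P i) x i `^ r.
Proof.
move=> x0; elim: s => [|i s IH]; first by rewrite !big_nil powR1.
rewrite !big_cons; case: ifP => // Pi.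
by rewrite powRM ?IH ?x0// prodr_ge0.
Qed.

(* A substitute for the weighted arithmetic-geometric mean inequality, enough
   for a form of Hoelder's inequality with a worse constant. *)
Lemma prod_powR_le_sum (I : finType) (th x : I -> R) :
  (forall i, 0 < th i) -> \sum_i th i = 1 -> (forall i, 0 <= x i) ->
  \prod_i x i `^ th i <= \sum_i x i.
Proof.
move=> th0 th1 x0; set S := \sum_i x i.
have xS i : x i <= S by rewrite /S (bigD1 i)//= lerDl sumr_ge0.
have S0 : 0 <= S by exact: sumr_ge0.
apply: (@le_trans _ _ (\prod_i S `^ th i)).
  apply: ler_prod => i _; rewrite powR_ge0/= ge0_ler_powR ?nnegrE// ?ltW//.
(* The exponents sum to 1, so an index [i0] exists; it makes the product vanish when [S] is 0. *)
have [i0 _|noI] := pickP (@predT I); last first.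
  have : (1 : R) = 0 by rewrite -th1 big_pred0// => i; have := noI i.
  by move/eqP; rewrite oner_eq0.
move: S0; rewrite le_eqVlt => /predU1P[<-|S0].
  by rewrite (bigD1 i0)//= powR0 ?mul0r// gt_eqF.
have powS a b : S `^ (a + b) = S `^ a * S `^ b.
  by rewrite powRD// (gt_eqF S0) implybT.
have := big_morph (fun t => S `^ t) powS (powRr0 S) (index_enum I) xpredT th.
by rewrite th1 powRr1 ?(ltW S0)// => <-.
Qed.

End PowerProducts.

(** * Linearisation of the maximum of a finite family *)

Section Linearisation.
Context {R : realType} d (Z : measurableType d) {T : eqType}.
Variables (W : T -> set Z) (A : T -> R).
Hypothesis mW : forall r, measurable (W r).

(** By induction, each new index [r0] takes the points of [W r0] where its value is at least the
    maximum over the rest, and these points are removed from the earlier sets. The maximum thus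
    becomes a single term wherever it is nonzero. *)
Lemma maxover_linearise (F : seq T) : uniq F -> exists E : T -> set Z,
  [/\ forall r, measurable (E r), forall r, E r `<=` W r,
      forall r s z, r \in F -> s \in F -> E r z -> E s z -> r = s &
      forall z, maxover F W A z = 0 \/
        exists r, [/\ r \in F, E r z & maxover F W A z = A r]].
Proof.
elim: F => [_|r0 F IH /= /andP[r0F uF]].
  exists (fun=> set0); split=> // [r z []|z]; left.
  by rewrite /maxover big_nil.
have [E [mE EW Edisj EM]] := IH uF.
pose E0 := W r0 `&` [set z | maxover F W A z <= A r0].
have mE0 : measurable E0.
  apply: measurableI => //.
  rewrite (_ : [set _ | _] = maxover F W A @^-1` `]-oo, A r0]); last first.
    by apply/seteqP; split=> x /=; rewrite in_itv.
  by rewrite -[X in measurable X]setTI; apply: measurable_maxover.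
exists (fun r => if r == r0 then E0 else E r `\` E0); split.
- by move=> r; case: ifP => // _; exact: measurableD.
- by move=> r; case: eqP => [->|_] z [] // /EW.
- move=> r s z; rewrite !inE; case: eqP => [->|_] /=; case: eqP => [->//|_] //=.
  + by move=> _ _ E0z [_ /(_ E0z)].
  + by move=> _ _ [_ nE0z] /nE0z.
  + by move=> rF sF [Er _] [Es _]; exact: (Edisj _ _ z).
move=> z; have ME : maxover (r0 :: F) W A z = Num.max (A r0 * \1_(W r0) z) (maxover F W A z).
  by rewrite /maxover big_cons.
have [E0z|nE0z] := pselect (E0 z).
  right; exists r0; rewrite eqxx mem_head; split=> //.
  case: E0z => Wz /= MA; rewrite ME indicE mem_set// mulr1.
  by apply/max_idPl.
have {}ME : maxover (r0 :: F) W A z = maxover F W A z.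
  rewrite ME; apply/max_idPr; rewrite indicE; have [Wz|_] := boolP (z \in W r0).
    rewrite mulr1; case: (leP (maxover F W A z) (A r0)) => [MA|/ltW//].
    by exfalso; apply: nE0z; split=> //; exact: set_mem.
  by rewrite mulr0 maxover_ge0.
rewrite ME; have [->|[r [rF Er ->]]] := EM z; [by left|right].
exists r; rewrite inE rF orbT ifF//.
by apply/eqP => rr0; rewrite -rr0 rF in r0F.
Qed.

End Linearisation.

(** * The estimate for a finite family of cubes of one grid *)

Section SingleGrid.
Context {R : realType} d (X : measurableType d) d' (Z : measurableType d').
Context {T : choiceType} (m : nat).
Variables (lam : {measure set X -> \bar R}) (mu : {measure set Z -> \bar R}).
Variables (F : seq T) (D : T -> set X) (W : T -> set Z) (rk vol : T -> R).
Hypotheses (mD : forall r, measurable (D r)) (mW : forall r, measurable (W r)).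
Hypothesis laminar : forall r s, rk r <= rk s -> D r `<=` D s \/ D r `&` D s = set0.
Hypothesis uF : uniq F.
Hypothesis vol0 : forall r, 0 < vol r.
Variables (ps : 'I_m -> R) (p : R).
Hypotheses (hm : (0 < m)%N) (hps : forall i, 1 < ps i).
Hypothesis (hp : p^-1 = \sum_(i < m) (ps i)^-1).
Variables (s f : 'I_m -> X -> R).
Hypotheses (ms : forall i, measurable_fun setT (s i)) (s0 : forall i x, 0 <= s i x).
Hypotheses (mf : forall i, measurable_fun setT (f i)) (f0 : forall i x, 0 <= f i x).

Let mass i r := (\int[lam]_(x in D r) (s i x)%:E)%E.
Let fmass i r := fine (\int[lam]_(x in D r) (f i x * s i x)%:E).
Let dens r := \prod_(i < m) (fine (mass i r) / vol r).
Let favg r := \prod_(i < m) (fmass i r / vol r).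
Let nu x := \prod_(i < m) s i x `^ (p / ps i).

Hypothesis mass_fin : forall i r, r \in F -> (0 < mass i r < +oo)%E.

Lemma exponent_gt0 : 0 < p.
Proof.
have ps0 i : 0 < (ps i)^-1 by rewrite invr_gt0 (lt_trans _ (hps i)).
rewrite -invr_gt0 hp (bigD1 (Ordinal hm))//= ltr_wpDr//.
by apply: sumr_ge0 => i _; exact: ltW.
Qed.

Lemma exponents_sum1 : \sum_(i < m) p / ps i = 1.
Proof. by rewrite -mulr_sumr -hp divff// gt_eqF// exponent_gt0. Qed.

(* In the packing hypothesis, [E] stands for any linearisation of the maximal
   function: the sets [E r] are disjoint and lie in the tents [W r]. *)
Lemma single_grid (B : R) (N : 'I_m -> R) : 0 <= B -> (forall i, 0 < N i) ->
  (forall i, \int[lam]_x (f i x `^ ps i * s i x)%:E <= (N i)%:E)%E ->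
  (forall E : T -> set Z, (forall r, measurable (E r)) -> (forall r, E r `<=` W r) ->
    (forall r s z, r \in F -> s \in F -> E r z -> E s z -> r = s) ->
    forall r, r \in F ->
    \sum_(t <- F | `[< D t `<=` D r >]) (dens t `^ p)%:E * mu (E t) <=
      B%:E * \int[lam]_(x in D r) (nu x)%:E)%E ->
  (\int[mu]_z (maxover F W favg z `^ p)%:E <=
    (B * (\sum_(i < m) doob_const (ps i)) * \prod_(i < m) N i `^ (p / ps i))%:E)%E.
Proof.
move=> B0 N0 fN pack.
have p0 := exponent_gt0.
have ps0 i : 0 < ps i by rewrite (lt_trans _ (hps i)).
have th0 i : 0 < p / ps i by rewrite divr_gt0.
have fmass0 i r : 0 <= fmass i r.
  by rewrite fine_ge0// integral_ge0// => x _; rewrite lee_fin mulr_ge0.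
have mass0 i r : (0 <= mass i r)%E by rewrite integral_ge0// => x _; rewrite lee_fin.
have favg0 r : 0 <= favg r.
  by apply: prodr_ge0 => i _; rewrite divr_ge0// ltW.
have dens0 r : 0 <= dens r.
  by apply: prodr_ge0 => i _; rewrite divr_ge0 ?fine_ge0// ltW.
have nu0 x : 0 <= nu x by apply: prodr_ge0 => i _; exact: powR_ge0.
have mpow r g : measurable_fun setT g -> measurable_fun setT (fun x : X => g x `^ r).
  by move=> mg; apply: (measurableT_comp (measurable_powR r)).
have mnu : measurable_fun setT nu by apply: measurable_prod => i _; exact: mpow.
(* The mean of [f i] over [D r] with respect to [s i]. Dividing by this mass splits [favg] into
   [dens], left to the packing hypothesis, and means left to Doob's inequality. *)
pose l i r := fmass i r / fine (mass i r).
have l0 i r : 0 <= l i r by rewrite divr_ge0// fine_ge0.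
pose L r := (\prod_(i < m) l i r) `^ p.
have L0 r : 0 <= L r by exact: powR_ge0.
have favgE r : r \in F -> favg r `^ p = dens r `^ p * L r.
  move=> rF; rewrite /L -powRM//; last exact: prodr_ge0.
  congr (_ `^ p); rewrite /dens -big_split/=; apply: eq_bigr => i _.
  have /andP[m0 mfin] := mass_fin i rF.
  rewrite /l mulrAC mulrCA divff ?mulr1//.
  by rewrite gt_eqF// fine_gt0// m0.
have [E [mE EW Edisj EM]] := maxover_linearise favg mW uF.
have step1 : (\int[mu]_z (maxover F W favg z `^ p)%:E <=
    \sum_(r <- F) (dens r `^ p)%:E * mu (E r) * (L r)%:E)%E.
  apply: (@le_trans _ _ (\int[mu]_z (\sum_(r <- F)
      (favg r `^ p)%:E * (\1_(E r) z)%:E))%E).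
    apply: ge0_le_integral_nonmeasurable => z _; first by rewrite lee_fin powR_ge0.
    - by apply: sume_ge0 => r _; rewrite -EFinM lee_fin mulr_ge0 ?powR_ge0.
    - split=> //; have [->|[r [rF Er ->]]] := EM z.
        rewrite powR0 ?gt_eqF//.
        by apply: sume_ge0 => r _; rewrite -EFinM lee_fin mulr_ge0 ?powR_ge0.
      rewrite (bigD1_seq r)//= indicE mem_set// mule1 leeDl//.
      by apply: sume_ge0 => t _; rewrite -EFinM lee_fin mulr_ge0 ?powR_ge0.
  rewrite ge0_integral_sum//; last 2 first.
  - move=> r; apply: measurable_funeM; apply/measurable_EFinP.
    exact: measurable_indic.
  - by move=> r z _; rewrite -EFinM lee_fin mulr_ge0 ?powR_ge0.
  rewrite big_seq [leRHS]big_seq; apply: lee_sum => r rF.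
  rewrite ge0_integralZl_EFin ?powR_ge0//; last by apply/measurable_EFinP; exact: measurable_indic.
  by rewrite integral_indic// setIT favgE// EFinM muleAC.
apply: (le_trans step1).
have a0 r : (0 <= (dens r `^ p)%:E * mu (E r))%E.
  by rewrite mule_ge0// lee_fin powR_ge0.
have C := carleson mD laminar uF L0 a0 B0 mnu nu0 (pack E mE EW Edisj).
apply: (le_trans C).
rewrite -mulrA EFinM; apply: lee_wpmul2l; first by rewrite lee_fin.
pose M i := maxover F D (l i).
have M0 i x : 0 <= M i x by exact: maxover_ge0.
have mM i : measurable_fun setT (M i) by exact: measurable_maxover.
(* The set attaining the maximum of the products is a competitor in each of the [m] separate
   maxima. *)
have MLle x : maxover F D L x <= (\prod_(i < m) M i x) `^ p.
  have [//|ML0] := leP (maxover F D L x) 0; first by move=> /le_trans; apply; exact: powR_ge0.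
  have [/(_ (lexx _))[r [rF Dr Mr]] _] := maxover_geP F D L x ML0.
  apply: (le_trans Mr); apply: ge0_ler_powR; rewrite ?nnegrE ?prodr_ge0//; first exact: ltW.
  apply: ler_prod => i _; rewrite l0/=.
  have [//|li0] := leP (l i r) 0; first by move=> /le_trans; apply.
  by apply/(maxover_geP F D (l i) x li0); exists r.
pose NN := \prod_(i < m) N i `^ (p / ps i).
have NN0 : 0 <= NN by apply: prodr_ge0 => i _; exact: powR_ge0.
have gei i x : 0 <= (N i)^-1 * (M i x `^ ps i * s i x).
  by rewrite mulr_ge0 ?invr_ge0 ?(ltW (N0 i))// mulr_ge0 ?powR_ge0.
(* Dividing by [N i] makes each term of the sum have integral at most a Doob constant, so replacing
   the geometric mean by a sum costs only the sum of these constants. *)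
have pt x : maxover F D L x * nu x <=
    NN * \sum_(i < m) (N i)^-1 * (M i x `^ ps i * s i x).
  apply: (@le_trans _ _ ((\prod_(i < m) M i x) `^ p * nu x)); first exact: ler_wpM2r.
  rewrite powR_prod// /nu -big_split/=.
  apply: (@le_trans _ _ (NN * \prod_(i < m) ((N i)^-1 * (M i x `^ ps i * s i x)) `^ (p / ps i))).
    rewrite /NN -big_split/= le_eqVlt; apply/orP; left; apply/eqP.
    apply: eq_bigr => i _; rewrite -powRM ?gei ?(ltW (N0 i))//.
    rewrite mulVKf ?gt_eqF// powRM ?powR_ge0// -powRrM.
    by rewrite mulrCA divff ?mulr1// gt_eqF.
  apply: ler_wpM2l => //; apply: prod_powR_le_sum => //; exact: exponents_sum1.
have mMs i : measurable_fun setT (fun x => ((M i x `^ ps i * s i x))%:E).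
  by apply/measurable_EFinP/measurable_funM => //; exact: mpow.
apply: (@le_trans _ _ (\int[lam]_x (NN%:E * \sum_(i < m)
    ((N i)^-1%:E * (M i x `^ ps i * s i x)%:E)))%E).
  apply: ge0_le_integral_nonmeasurable => x _; first by rewrite lee_fin mulr_ge0// maxover_ge0.
  - apply: mule_ge0; rewrite ?lee_fin//; apply: sume_ge0 => i _.
    by rewrite -EFinM lee_fin gei.
  - by split=> //; under eq_bigr do rewrite -EFinM; rewrite sumEFin -EFinM lee_fin.
have ge0i i x : (0 <= (N i)^-1%:E * (M i x `^ ps i * s i x)%:E)%E.
  by rewrite -EFinM lee_fin gei.
rewrite ge0_integralZl_EFin//; last 2 first.
- by move=> x _; apply: sume_ge0.
- by apply: emeasurable_sum => i; exact: measurable_funeM.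
rewrite mulrC EFinM; apply: lee_wpmul2l; first by rewrite lee_fin.
rewrite ge0_integral_sum//; last by move=> i; exact: measurable_funeM.
rewrite -sumEFin; apply: lee_sum => i _.
rewrite ge0_integralZl_EFin//; last 2 first.
- by move=> x _; rewrite lee_fin mulr_ge0 ?powR_ge0.
- by rewrite invr_ge0 ltW.
have dI : (\int[lam]_x (M i x `^ ps i * s i x)%:E <=
    (doob_const (ps i))%:E * (N i)%:E)%E.
  apply: (@le_trans _ _ ((doob_const (ps i))%:E *
      \int[lam]_x (f i x `^ ps i * s i x)%:E)%E); last first.
    by apply: lee_wpmul2l => //; rewrite lee_fin ltW// doob_const_gt0.
  apply: (doob (rk := rk)) => // r rF; first by have /andP[] := mass_fin i rF.
  have /andP[m0 mfin] := mass_fin i rF.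
  rewrite -/(mass i r) -(fineK (_ : mass i r \is a fin_num)) ?ge0_fin_numE//.
  rewrite -EFinM /l divfK ?gt_eqF ?fine_gt0 ?m0//.
  have : (0 <= \int[lam]_(x in D r) (f i x * s i x)%:E)%E.
    by rewrite integral_ge0// => x _; rewrite lee_fin mulr_ge0.
  (* [fine] turns an infinite integral into 0, and in that case the weak type bound is trivial. *)
  rewrite /fmass; case: (\int[lam]_(x in D r) _)%E => //= _; exact: leey.
apply: (@le_trans _ _ ((N i)^-1%:E * ((doob_const (ps i))%:E * (N i)%:E))%E).
  by apply: lee_wpmul2l => //; rewrite lee_fin invr_ge0 ltW.
by rewrite -!EFinM lee_fin mulrCA mulVf ?mulr1// gt_eqF.
Qed.

End SingleGrid.

(** * Shifted dyadic grids *)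

Section Grid1.
Context {R : realType}.
Implicit Types (b : bool) (k a : int).

(* The left end points of the intervals of length [2 ^ k] of two dyadic grids of
   the line. The grid [b = true] is shifted by [(-1) ^ k * 2 ^ k / 3]: the
   alternating sign makes the intervals of consecutive scales nested. *)
Definition grid_shift b k : R := if b then (-1) ^ k / 3 else 0.

Definition grid_left b k a : R := 2 ^ k * (a%:~R + grid_shift b k).

Let twok k : 0 < 2 ^ k :> R. Proof. exact: exprz_gt0. Qed.

Lemma exprN1z k : ((-1) ^ k = 1 :> R) \/ ((-1) ^ k = -1 :> R).
Proof.
have H n : ((-1) ^+ n = 1 :> R) \/ ((-1) ^+ n = -1 :> R).
  by rewrite -signr_odd; case: odd; [right|left]; rewrite ?expr1 ?expr0.
case: k => n /=; first exact: H.
by case: (H n.+1) => E; rewrite /exprz E ?invrN1 ?invr1; [left|right].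
Qed.

(** Write e = (-1)^k. In units of 2^k the shift at scale k + 1 is -2e/3 = e/3 - e, the shift at
    scale k up to an integer; hence the witnesses [2 * a - 1] and [2 * a + 1]. *)
Lemma grid_left_succ b k a : exists u, grid_left b (k + 1) a = grid_left b k u.
Proof.
have E : 2 ^ (k + 1) = 2 * 2 ^ k :> R by rewrite exprzDr ?unitfE ?pnatr_eq0// expr1z mulrC.
have S : (-1) ^ (k + 1) = - (-1) ^ k :> R.
  by rewrite exprzDr ?unitrN1// expr1z mulrN1.
rewrite /grid_left /grid_shift E S; case: b; last first.
  by exists (2 * a); rewrite intrM; ring.
case: (exprN1z k) => ->.
  by exists (2 * a - 1); rewrite intrB intrM; field.
by exists (2 * a + 1); rewrite intrD intrM; field.
Qed.

Lemma grid_left_refine b k k' a : k <= k' ->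
  exists u, grid_left b k' a = grid_left b k u.
Proof.
move=> kk'; have [j ->] : exists j : nat, k' = k + j%:Z.
  move: kk'; rewrite -subr_ge0; case E : (k' - k) => [j|//] _.
  by exists j; rewrite -E [RHS]addrC subrK.
elim: j a => [|j IH] a; first by exists a; rewrite addr0.
have -> : k + j.+1%:Z = k + j%:Z + 1 by rewrite intS addrA addrAC.
have [u ->] := grid_left_succ b (k + j%:Z) a; exact: IH.
Qed.

Lemma grid_leftD b k a : grid_left b k a + 2 ^ k = grid_left b k (a + 1).
Proof. by rewrite /grid_left intrD; ring. Qed.

Lemma ltr_grid_left b k a a' : (grid_left b k a < grid_left b k a') = (a < a').
Proof. by rewrite /grid_left ltr_pM2l// ltrD2r ltr_int. Qed.

Lemma ler_grid_left b k a a' : (grid_left b k a <= grid_left b k a') = (a <= a').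
Proof. by rewrite !leNgt ltr_grid_left. Qed.

(** Both ends of the coarser interval are end points of the finer grid, so the comparison reduces to
    one between integers. *)
Lemma grid_nested b k k' a a' x : k <= k' ->
  grid_left b k a <= x < grid_left b k a + 2 ^ k ->
  grid_left b k' a' <= x < grid_left b k' a' + 2 ^ k' ->
  grid_left b k' a' <= grid_left b k a /\
  grid_left b k a + 2 ^ k <= grid_left b k' a' + 2 ^ k'.
Proof.
move=> kk'; rewrite !grid_leftD => /andP[ax xa] /andP[a'x xa'].
have [u uE] := grid_left_refine b a' kk'.
have [v vE] := grid_left_refine b (a' + 1) kk'.
move: a'x xa'; rewrite uE vE !ler_grid_left => ux xv.
have := le_lt_trans ux xa; rewrite ltr_grid_left => uxa.
have := le_lt_trans ax xv; rewrite ltr_grid_left => axv.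
by split; [rewrite -ltzD1|rewrite lezD1].
Qed.

(** After rescaling by 2^k the interval is shorter than 1/3. If it reaches the next integer, the
    unshifted grid may fail, but the end points of the shifted grid are at distance 1/3 from the
    integers and are then missed. *)
Lemma grid_cover1 k (y l : R) : 0 < l -> 3 * l < 2 ^ k ->
  exists b a, grid_left b k a <= y /\ y + l < grid_left b k a + 2 ^ k.
Proof.
move=> l0 lk; set h := 2 ^ k in lk *.
have h0 : 0 < h by exact: twok.
pose t := y / h; pose e := l / h.
have yE : y = h * t by rewrite /t mulrC divfK// gt_eqF.
have lE : l = h * e by rewrite /e mulrC divfK// gt_eqF.
have e3 : 3 * e < 1 by rewrite /e mulrA ltr_pdivrMr// mul1r.
have e0 : 0 < e by rewrite divr_gt0.
suff [b [a [at1 at2]]] : exists b a, a%:~R + grid_shift b k <= t /\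
    t + e < a%:~R + grid_shift b k + 1.
  exists b, a; rewrite /grid_left -/h yE lE; split; first by rewrite ler_pM2l.
  by rewrite -mulrDr -[X in _ < _ + X]mulr1 -mulrDr ltr_pM2l.
have /andP[ft tf] := floor_itv t; set a := Num.floor t in ft tf.
move: tf; rewrite intrD => tf.
have [te|te] := ltP (t + e) (a%:~R + 1).
  by exists false, a; rewrite /grid_shift addr0.
exists true; rewrite /grid_shift; case: (exprN1z k) => ->.
  by exists a; split; lra.
by exists (a + 1); rewrite intrD; split; lra.
Qed.

Lemma dyadic_scale (y : R) : 0 < y -> exists k : int, y < 2 ^ k <= 2 * y.
Proof.
move=> y0; have l2 : 0 < ln 2 :> R by rewrite ln_gt0// ltr1n.
pose k := Num.floor (ln y / ln 2) + 1; exists k.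
have pE (z : int) : 2 ^ z = expR (z%:~R * ln 2) :> R.
  by rewrite -powR_intmul// /powR pnatr_eq0.
have yE : y = expR (ln y / ln 2 * ln 2).
  by rewrite divfK ?gt_eqF// lnK.
have /andP[f1 f2] := floor_itv (ln y / ln 2).
apply/andP; split.
  by rewrite pE {1}yE ltr_expR ltr_pM2r.
rewrite /k exprzDr ?unitfE ?pnatr_eq0// expr1z mulrC ler_pM2l// pE {2}yE.
by rewrite ler_expR ler_pM2r.
Qed.

End Grid1.

(** * Dyadic grids of cubes in R^n and their tents *)

Section Grid.
Context {R : realType} {n : nat}.
Local Notation Rn := (euclidean R n).
Local Notation leb := (lebesgue R n).
Local Notation index := (int * {ffun 'I_n -> int})%type.
Implicit Types (al : {ffun 'I_n -> bool}) (r : index) (Q : cube R n).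

(** [al] selects one of the two grids in each coordinate, which gives 2^n grids; [r] consists of a
    scale and a position. Half-open cells make each grid laminar. *)
Definition grid_cube al r : set Rn := [set x | forall i,
  grid_left (al i) r.1 (r.2 i) <= tnth x i < grid_left (al i) r.1 (r.2 i) + 2 ^ r.1].

Definition grid_tent al r : set (Rn * measurableTypeR R) :=
  [set z | grid_cube al r z.1 /\ 0 <= z.2 < 2 ^ r.1].

(** The closure of the cell, to which the testing and reverse Hölder conditions, stated for closed
    cubes, can be applied. *)
Definition closed_grid_cube al r : cube R n :=
  Cube [tuple grid_left (al i) r.1 (r.2 i) | i < n] (exprz_gt0 r.1 (ltr0n R 2)).

Lemma measurable_coordinates (A : 'I_n -> set R) :
  (forall i, measurable (A i)) -> measurable [set x : Rn | forall i, A i (tnth x i)].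
Proof.
move=> mA; rewrite (_ : [set _ | _] =
    \bigcap_(i in [set: 'I_n]) ((fun x : Rn => tnth x i) @^-1` A i)); last first.
  by apply/seteqP; split=> x /= H i; [move=> _; exact: H|exact: (H i I)].
apply: fin_bigcap_measurable => // i _.
by rewrite -[X in measurable X]setTI; apply: measurable_tnth; [exact: measurableT|exact: mA].
Qed.

Lemma measurable_cube Q : measurable (Q : set Rn).
Proof.
rewrite (_ : (Q : set Rn) = [set x : Rn | forall i,
    `[tnth (corner Q) i, tnth (corner Q) i + side Q]%classic (tnth x i)]).
  exact: (measurable_coordinates (A := fun i =>
    `[tnth (corner Q) i, tnth (corner Q) i + side Q]%classic)).
by apply/seteqP; split=> x Qx i; have := Qx i; rewrite /= in_itv.
Qed.

Lemma measurable_grid_cube al r : measurable (grid_cube al r).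
Proof.
rewrite (_ : grid_cube al r = [set x : Rn | forall i,
    `[grid_left (al i) r.1 (r.2 i), grid_left (al i) r.1 (r.2 i) + 2 ^ r.1[%classic (tnth x i)]).
  exact: (measurable_coordinates (A := fun i =>
    `[grid_left (al i) r.1 (r.2 i), grid_left (al i) r.1 (r.2 i) + 2 ^ r.1[%classic)).
by apply/seteqP; split=> x Qx i; have := Qx i; rewrite /= in_itv.
Qed.

Lemma measurable_height (A : set R) : measurable A ->
  measurable [set z : Rn * measurableTypeR R | A z.2].
Proof.
move=> mA; rewrite (_ : [set _ | _] = snd @^-1` A)//.
by rewrite -[X in measurable X]setTI; exact: measurable_snd.
Qed.

Lemma measurable_base (A : set Rn) : measurable A ->
  measurable [set z : Rn * measurableTypeR R | A z.1].
Proof.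
move=> mA; rewrite (_ : [set _ | _] = fst @^-1` A)//.
by rewrite -[X in measurable X]setTI; exact: measurable_fst.
Qed.

Lemma measurable_half_space : measurable (@half_space R n).
Proof.
rewrite (_ : @half_space R n = [set z | `[(0 : R), +oo[%classic z.2]).
  by apply: (measurable_height (A := `[(0 : R), +oo[%classic)); exact: measurable_itv.
by apply/seteqP; split=> z; rewrite /half_space/= in_itv/= andbT.
Qed.

Lemma measurable_tent Q : measurable (tent Q).
Proof.
rewrite (_ : tent Q = [set z | (Q : set Rn) z.1] `&` [set z | `[(0 : R), side Q[%classic z.2]).
  apply: measurableI; first by apply: measurable_base; exact: measurable_cube.
  by apply: (measurable_height (A := `[(0 : R), side Q[%classic)); exact: measurable_itv.
by apply/seteqP; split=> z; rewrite /tent/= in_itv.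
Qed.

Lemma measurable_grid_tent al r : measurable (grid_tent al r).
Proof.
rewrite (_ : grid_tent al r =
    [set z | grid_cube al r z.1] `&` [set z | `[(0 : R), 2 ^ r.1[%classic z.2]).
  apply: measurableI; first by apply: measurable_base; exact: measurable_grid_cube.
  by apply: (measurable_height (A := `[(0 : R), 2 ^ r.1[%classic)); exact: measurable_itv.
by apply/seteqP; split=> z; rewrite /grid_tent/= in_itv.
Qed.

Lemma grid_laminar al r s : (2 ^ r.1 <= 2 ^ s.1 :> R) ->
  grid_cube al r `<=` grid_cube al s \/ grid_cube al r `&` grid_cube al s = set0.
Proof.
rewrite ler_eXz2l ?ltr1n// => rs.
have [[x [rx sx]]|nx] := pselect (exists x, (grid_cube al r `&` grid_cube al s) x).
  left=> y ry i; have [h1 h2] := grid_nested rs (rx i) (sx i).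
  by have /andP[y1 y2] := ry i; rewrite (le_trans h1 y1) (lt_le_trans y2 h2).
by right; apply/eqP; rewrite -[_ == _]negbK; apply/negP => /set0P.
Qed.

Lemma grid_cube_sub al r : grid_cube al r `<=` closed_grid_cube al r.
Proof. by move=> x rx i; have /andP[x1 x2] := rx i; rewrite tnth_mktuple x1 ltW. Qed.

(** The difference is covered by the [n] upper faces, which are boxes with one side of length 0. *)
Lemma grid_cube_boundary al r :
  leb (closed_grid_cube al r `\` grid_cube al r) = 0%E.
Proof.
pose a := corner (closed_grid_cube al r).
have ai i : tnth a i = grid_left (al i) r.1 (r.2 i) by rewrite tnth_mktuple.
pose lo j : Rn := [tuple if i == j then tnth a i + 2 ^ r.1 else tnth a i | i < n].
pose hi : Rn := [tuple tnth a i + 2 ^ r.1 | i < n].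
pose face j := [set x : Rn | forall i, tnth (lo j) i <= tnth x i <= tnth hi i].
have two0 : 0 < 2 ^ r.1 :> R by exact: exprz_gt0.
have lohi j i : tnth (lo j) i <= tnth hi i.
  by rewrite !tnth_mktuple; case: ifP => // _; rewrite lerDl ltW.
have mface j : measurable (face j).
  rewrite (_ : face j = [set x : Rn | forall i, `[tnth (lo j) i, tnth hi i]%classic (tnth x i)]).
    exact: (measurable_coordinates (A := fun i => `[tnth (lo j) i, tnth hi i]%classic)).
  by apply/seteqP; split=> x Qx i; have := Qx i; rewrite /= in_itv.
have face0 j : leb (face j) = 0%E.
  rewrite lebesgue_box//; congr EFin; apply/eqP/prodf_eq0; exists j => //.
  by rewrite !tnth_mktuple eqxx subrr.
have sub : closed_grid_cube al r `\` grid_cube al r `<=` \big[setU/set0]_(j < n) face j.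
  move=> x [cx nx].
  have [j nj] : exists j, ~ (grid_left (al j) r.1 (r.2 j) <= tnth x j <
      grid_left (al j) r.1 (r.2 j) + 2 ^ r.1).
    by apply: contrapT => H; apply: nx => j; apply: contrapT => Hj; apply: H; exists j.
  rewrite -bigcup_seq; exists j => /=; first by rewrite mem_index_enum.
  move=> i; rewrite !tnth_mktuple; have /andP[] := cx i; rewrite tnth_mktuple => c1 c2.
  case: eqP => [->|_]; last by rewrite c1.
  have := cx j; rewrite tnth_mktuple => /andP[d1 d2]; rewrite d2 andbT leNgt.
  by apply/negP => d3; apply: nj; rewrite d1.
apply: measure_negligible.
  by apply: measurableD; [exact: measurable_cube|exact: measurable_grid_cube].
apply: negligibleS sub _; elim/big_ind: _ => [|A B nA nB|j _].
- exact: negligible_set0.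
- exact: negligibleU.
- by apply/negligibleP; [exact: mface|exact: face0].
Qed.

(** The scale 2^k is taken above 3 times the side and at most 6 times it; every coordinate then
    chooses its grid separately at this common scale. *)
Lemma grid_cover Q : exists al r,
  [/\ (Q : set Rn) `<=` grid_cube al r, side Q < 2 ^ r.1 & 2 ^ r.1 <= 6 * side Q].
Proof.
have s0 := side_gt0 Q.
have [|k /andP[k1 k2]] := @dyadic_scale R (3 * side Q); first by rewrite mulr_gt0.
have /choice[ba baP] : forall i : 'I_n, exists ba : bool * int,
    grid_left ba.1 k ba.2 <= tnth (corner Q) i /\
    tnth (corner Q) i + side Q < grid_left ba.1 k ba.2 + 2 ^ k.
  move=> i; have [b [a ab]] := grid_cover1 (tnth (corner Q) i) s0 k1.
  by exists (b, a).
exists [ffun i => (ba i).1], (k, [ffun i => (ba i).2]); split=> /=; last 2 first.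
- by apply: le_lt_trans k1; rewrite ler_peMl ?ler1n// ltW.
- by apply: le_trans k2 _; rewrite mulrA -natrM.
move=> x Qx i; rewrite !ffunE/=; have [b1 b2] := baP i.
by have /andP[x1 x2] := Qx i; rewrite (le_trans b1 x1) (le_lt_trans x2 b2).
Qed.

End Grid.

(** * Products of nonnegative extended reals *)

Section EProducts.
Context {R : realType}.
Local Open Scope ereal_scope.

Lemma lee_prod (I : Type) (r : seq I) (P : pred I) (x y : I -> \bar R) :
  (forall i, P i -> 0 <= x i) -> (forall i, P i -> x i <= y i) ->
  \prod_(i <- r | P i) x i <= \prod_(i <- r | P i) y i.
Proof.
move=> x0 xy; elim: r => [|i r IH]; first by rewrite !big_nil.
rewrite !big_cons; case: ifP => // Pi.
by apply: lee_pmul; [exact: x0|exact: prode_ge0|exact: xy|].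
Qed.

Lemma prode_eq0 (I : finType) (x : I -> \bar R) (i : I) : x i = 0 -> \prod_i x i = 0.
Proof. by move=> xi; rewrite (bigD1 i)//= xi mul0e. Qed.

Lemma prode_gt0 (I : Type) (r : seq I) (x : I -> \bar R) :
  (forall i, 0 < x i) -> 0 < \prod_(i <- r) x i.
Proof.
move=> x0; elim: r => [|i r IH]; first by rewrite big_nil.
by rewrite big_cons mule_gt0.
Qed.

(** Positivity of the other factors matters because 0 times +oo is 0. *)
Lemma prode_eqy (I : finType) (x : I -> \bar R) (i : I) :
  (forall i, 0 < x i) -> x i = +oo -> \prod_i x i = +oo.
Proof.
move=> x0 xi; rewrite (bigD1 i)//= xi gt0_mulye// -big_filter.
exact: prode_gt0.
Qed.

End EProducts.

(** * Averages, the maximal operator and integrals over cubes *)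

Section Cubes.
Context {R : realType} {n : nat}.
Local Notation Rn := (euclidean R n).
Local Notation leb := (lebesgue R n).
Implicit Types (Q : cube R n) (g : Rn -> R).
Local Open Scope ereal_scope.

Lemma averageE Q g :
  average Q g = ((side Q ^+ n)^-1)%:E * \int[leb]_(y in Q) `|g y|%:E.
Proof.
have s0 : (0 < side Q ^+ n)%R by rewrite exprn_gt0// side_gt0.
by rewrite /average lebesgue_cube inver (gt_eqF s0).
Qed.

Lemma average_ge0 Q g : 0 <= average Q g.
Proof.
rewrite averageE mule_ge0//; first by rewrite lee_fin invr_ge0 exprn_ge0// ltW// side_gt0.
by apply: integral_ge0 => x _; rewrite lee_fin.
Qed.

Context {m : nat}.
Implicit Types (f : 'I_m -> Rn -> R).

Lemma le_maximal f z Q : (Q : set Rn) z.1 -> (z.2 <= side Q)%R ->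
  \prod_(i < m) average Q (f i) <= maximal f z.
Proof. by move=> Qz zQ; apply: ereal_sup_ubound; exists Q. Qed.

Lemma maximal_le f z B :
  (forall Q, (Q : set Rn) z.1 -> (z.2 <= side Q)%R -> \prod_(i < m) average Q (f i) <= B) ->
  maximal f z <= B.
Proof. by move=> H; apply: ge_ereal_sup => _ [Q [Qz zQ] <-]; exact: H. Qed.

(** This keeps the supremum in [maximal] from running over the empty set, where it would be -oo. *)
Lemma cube_around (z : Rn * measurableTypeR R) :
  exists Q, (Q : set Rn) z.1 /\ (z.2 <= side Q)%R.
Proof.
have s0 : (0 < `|z.2| + 1)%R by rewrite ltr_wpDl.
exists (Cube z.1 s0); split=> /= [i|]; first by rewrite lexx lerDl ltW.
by rewrite (le_trans (ler_norm _))// lerDl.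
Qed.

Lemma maximal_ge0 f z : 0 <= maximal f z.
Proof.
have [Q [Qz zQ]] := cube_around z; apply: le_trans (le_maximal f Qz zQ).
by apply: prode_ge0 => i _; exact: average_ge0.
Qed.

Lemma average_le Q g h : (forall x, (Q : set Rn) x -> `|g x| <= `|h x|)%R ->
  average Q g <= average Q h.
Proof.
move=> gh; rewrite !averageE; apply: lee_wpmul2l.
  by rewrite lee_fin invr_ge0 exprn_ge0// ltW// side_gt0.
by apply: ge0_le_integral_nonmeasurable => x Qx; rewrite ?lee_fin//; split=> //; exact: gh.
Qed.

Lemma eq_average Q g h : (forall x, (Q : set Rn) x -> `|g x| = `|h x|)%R ->
  average Q g = average Q h.
Proof. by move=> gh; apply/eqP; rewrite eq_le !average_le// => x /gh ->. Qed.

Lemma ae_eq_average Q g h : measurable_fun setT g -> measurable_fun setT h ->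
  {ae leb, forall x, g x = h x} -> average Q g = average Q h.
Proof.
move=> mg mh gh; rewrite !averageE; congr (_ * _).
apply: ae_eq_integral => //; first exact: measurable_cube.
- by apply/measurable_EFinP/measurable_funTS/measurableT_comp.
- by apply/measurable_EFinP/measurable_funTS/measurableT_comp.
- by apply: filterS gh => x -> _.
Qed.

(** The boundary is null; this carries the hypotheses on closed cubes over to the half-open
    cells. *)
Lemma integral_closed_grid_cube al r (h : Rn -> R) :
  measurable_fun setT h -> (forall x, 0 <= h x)%R ->
  \int[leb]_(x in closed_grid_cube al r) (h x)%:E = \int[leb]_(x in grid_cube al r) (h x)%:E.
Proof.
move=> mh h0.
rewrite (ge0_negligible_integral _ _ _ _ (grid_cube_boundary al r)).
- congr (integral _ _ _); apply/seteqP; split=> x /=.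
    by move=> [cx nx]; apply: contrapT => gx; apply: nx.
  by move=> gx; split; [exact: grid_cube_sub|case].
- by apply: measurableD; [exact: measurable_cube|exact: measurable_grid_cube].
- exact: measurable_cube.
- by apply: measurable_funTS; apply/measurable_EFinP.
- by move=> x _; rewrite lee_fin.
Qed.

Lemma lebesgue_grid_cube al r : leb (grid_cube al r) = ((2 ^ r.1) ^+ n)%:E.
Proof.
have := @integral_closed_grid_cube al r (cst 1%R) (measurable_cst _) (fun=> ler01).
have E (A : set Rn) : measurable A -> \int[leb]_(x in A) (cst 1%R x)%:E = leb A.
  by move=> mA; rewrite (integral_cst leb mA 1%E) mul1e.
by rewrite !E ?lebesgue_cube//; [exact: measurable_grid_cube|exact: measurable_cube].
Qed.

(** Lebesgue measures are compared, which see the scale only in positive dimension. As a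
    consequence, the tent over a smaller cell is no taller than that over a larger one. *)
Lemma grid_cube_subset_scale al r s : (0 < n)%N ->
  @grid_cube R n al r `<=` grid_cube al s -> (2 ^ r.1 <= 2 ^ s.1 :> R)%R.
Proof.
move=> n0 rs.
have : leb (grid_cube al r) <= leb (grid_cube al s).
  by apply: le_measure; rewrite ?inE//; exact: measurable_grid_cube.
rewrite !lebesgue_grid_cube lee_fin ler_pXn2r// ?nnegrE// ltW// exprz_gt0//.
Qed.

(** A zero integral would force [h] to vanish almost everywhere on a set of positive measure. *)
Lemma integral_cube_gt0 Q (h : Rn -> R) : measurable_fun setT h ->
  (forall x, 0 <= h x)%R -> {ae leb, forall x, (0 < h x)%R} ->
  0 < \int[leb]_(x in Q) (h x)%:E.
Proof.
move=> mh h0 hpos; rewrite lt0e integral_ge0 ?andbT; last by move=> x _; rewrite lee_fin.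
apply/negP => /eqP I0.
have mQ := measurable_cube Q.
have : ae_eq leb (Q : set Rn) (EFin \o h) (cst 0).
  apply/ae_eq_integral_abs => //; first by apply: measurable_funTS; apply/measurable_EFinP.
  by rewrite -[RHS]I0; apply: eq_integral => x _; rewrite /= ger0_norm.
move=> H; have : leb.-negligible (Q : set Rn).
  have [N [mN N0 hN]] : {ae leb, forall x, ~ (Q : set Rn) x}.
    apply: filterS2 H hpos => x /= Hx hx Qx; have := Hx Qx => -[] hx0.
    by rewrite hx0 ltxx in hx.
  by exists N; split=> // x Qx; apply: hN => /=; exact.
move=> nQ; have : leb Q = 0 by exact: measure_negligible.
rewrite lebesgue_cube => -[] /eqP.
by rewrite gt_eqF// exprn_gt0// side_gt0.
Qed.

End Cubes.

(** * The dual weight *)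

Section DualWeight.
Context {R : realType} {n : nat}.
Local Notation Rn := (euclidean R n).
Variables (q : R) (v : Rn -> R).
Hypothesis q1 : 1 < q.

Lemma dual_weight_ge0 x : 0 <= dual_weight q v x.
Proof. exact: powR_ge0. Qed.

Lemma measurable_dual_weight : measurable_fun setT v -> measurable_fun setT (dual_weight q v).
Proof. by move=> mv; apply: (measurableT_comp (measurable_powR _)). Qed.

Lemma dual_weight_gt0 x : 0 < v x -> 0 < dual_weight q v x.
Proof. exact: powR_gt0. Qed.

(** The exponent e = 1 - q' satisfies qe + 1 = e; adding exponents uses [0 < v x]. *)
Lemma dual_weight_powR x : 0 < v x -> dual_weight q v x `^ q * v x = dual_weight q v x.
Proof.
move=> v0; rewrite /dual_weight -powRrM -{2}[v x]powRr1 ?ltW// -powRD; last first.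
  by rewrite (gt_eqF v0) implybT.
by congr (_ `^ _); field; rewrite gt_eqF// subr_gt0.
Qed.

End DualWeight.

(** * Sufficiency of the testing condition *)

Section Sufficiency.
Context {R : realType} {m n : nat}.
Local Notation Rn := (euclidean R n).
Local Notation leb := (lebesgue R n).
Local Notation index := (int * {ffun 'I_n -> int})%type.
Variables (ps : 'I_m -> R) (p : R).
Hypotheses (hm : (0 < m)%N) (hn : (0 < n)%N) (hps : forall i, 1 < ps i).
Hypothesis (hp : p^-1 = \sum_(i < m) (ps i)^-1).
Variable mu : {measure set (Rn * measurableTypeR R) -> \bar R}.
Variable w : 'I_m -> Rn -> R.
Hypotheses (mw : forall i, measurable_fun setT (w i)).
Hypothesis wpos : forall i, {ae leb, forall x, 0 < w i x}.

Let s i := dual_weight (ps i) (w i).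
Let ms i : measurable_fun setT (s i).
Proof. exact: measurable_dual_weight. Qed.
Let s0 i x : 0 <= s i x. Proof. exact: powR_ge0. Qed.
Let p0 : 0 < p. Proof. exact: (exponent_gt0 hm hps hp). Qed.
Let ps0 i : 0 < ps i. Proof. by rewrite (lt_trans _ (hps i)). Qed.

Lemma dual_mass_gt0 (Q : cube R n) i : (0 < \int[leb]_(x in Q) (s i x)%:E)%E.
Proof.
apply: integral_cube_gt0 => //.
by apply: filterS (wpos i) => x; exact: dual_weight_gt0.
Qed.

Hypothesis hfin : forall (Q : cube R n) i, (\int[leb]_(x in Q) (s i x)%:E < +oo)%E.

Variables (K TC : R).
Hypotheses (TC0 : 0 <= TC) (hTC : (testing_constant mu ps p w <= TC%:E)%E).
Hypothesis hK : reverse_hoelder_bound ps p w K.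

(** On the unit cube the left side of the reverse Hölder inequality is positive, because the dual
    weights have positive mass. *)
Lemma reverse_hoelder_bound_gt0 : 0 < K.
Proof.
pose Q : cube R n := Cube [tuple 0 | i < n] ltr01.
have nu0 : (0 <= \int[leb]_(x in Q) (\prod_(i < m) s i x `^ (p / ps i))%:E)%E.
  by apply: integral_ge0 => x _; rewrite lee_fin prodr_ge0// => i _; exact: powR_ge0.
rewrite ltNge; apply/negP => K0; have := hK Q; apply/negP; rewrite -ltNge.
apply: (@le_lt_trans _ _ 0%E); first by rewrite mule_le0_ge0.
by apply: prode_gt0 => i; apply: poweR_gt0; exact: dual_mass_gt0.
Qed.

(** Testing bounds the integral by a product of powers of the masses of the [s i], and the reverse
    Hölder condition turns this product into an integral, which is additive over disjoint cubes as a
    Carleson estimate needs. *)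
Lemma testing_cube (Q : cube R n) :
  (\int[mu]_(z in tent Q) maximal (fun i x => s i x * \1_Q x)%R z `^ p <=
   (TC `^ p * K)%:E * \int[leb]_(x in Q) (\prod_(i < m) s i x `^ (p / ps i))%:E)%E.
Proof.
have mE i : (\int[leb]_(x in Q) (s i x)%:E = (fine (\int[leb]_(x in Q) (s i x)%:E))%:E)%E.
  by rewrite fineK// ge0_fin_numE// ltW// dual_mass_gt0.
pose a i := fine (\int[leb]_(x in Q) (s i x)%:E).
have a0 i : 0 < a i by rewrite fine_gt0// dual_mass_gt0/= hfin.
pose y := \prod_(i < m) a i `^ (ps i)^-1.
have y0 : 0 < y by apply: prodr_gt0 => i _; exact: powR_gt0.
set I := (X in (X <= _)%E).
have I0 : (0 <= I)%E by apply: integral_ge0 => z _; exact: poweR_ge0.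
have : (equotient (I `^ p^-1) y%:E <= TC%:E)%E.
  apply: le_trans hTC; apply: ereal_sup_ubound; exists Q => //.
  congr equotient; rewrite /y -prodEFin; apply: eq_bigr => i _.
  by rewrite -poweR_EFin /a -mE.
rewrite /equotient; case: eqP => [_|_]; first by rewrite leye_eq.
rewrite inver (gt_eqF y0) lee_pdivrMr// => H.
rewrite -(poweRVK p0 I0).
apply: (@le_trans _ _ ((TC%:E * y%:E) `^ p)%E).
  by apply: poweR_le => //; [exact: ltW|exact: poweR_ge0].
rewrite -EFinM poweR_EFin powRM ?(ltW y0)// !EFinM -muleA.
apply: lee_wpmul2l; first by rewrite lee_fin powR_ge0.
apply: le_trans (hK Q); rewrite /y powR_prod; last by move=> i _; exact: powR_ge0.
rewrite -prodEFin; apply: lee_prod => i _; first by rewrite lee_fin powR_ge0.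
by rewrite -powRrM (mulrC _ p) -poweR_EFin /a -mE.
Qed.

Variables (f : 'I_m -> Rn -> R) (N : 'I_m -> R).
Hypotheses (mf : forall i, measurable_fun setT (f i)) (f0 : forall i x, 0 <= f i x).
Hypotheses (N0 : forall i, 0 < N i)
  (fN : forall i, (\int[leb]_x (f i x `^ ps i * s i x)%:E <= (N i)%:E)%E).

Let S := \sum_(i < m) doob_const (ps i).
Let favg al (r : index) : R :=
  \prod_(i < m) (fine (\int[leb]_(x in grid_cube al r) (f i x * s i x)%:E) / (2 ^ r.1) ^+ n).

(** The packing hypothesis of [single_grid] is checked pointwise. The sets [E t] are disjoint, and
    at a point of [E t] the closed cube of [t] is admissible for the maximal function of the dual
    weights cut off to [Q], which therefore dominates [dens t]. *)
Lemma finite_grid_estimate al (F : seq index) : uniq F ->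
  (\int[mu]_z (maxover F (grid_tent al) (favg al) z `^ p)%:E <=
    (TC `^ p * K * S * \prod_(i < m) N i `^ (p / ps i))%:E)%E.
Proof.
move=> uF.
have K0 := ltW reverse_hoelder_bound_gt0.
have vol0 (r : index) : 0 < (2 ^ r.1) ^+ n :> R by rewrite exprn_gt0// exprz_gt0.
have gE al' r i : (\int[leb]_(x in closed_grid_cube al' r) (s i x)%:E =
   \int[leb]_(x in grid_cube al' r) (s i x)%:E)%E by exact: integral_closed_grid_cube.
apply: (@single_grid R _ Rn _ _ _ m leb mu F (grid_cube al) (grid_tent al)
  (fun r => 2 ^ r.1) (fun r => (2 ^ r.1) ^+ n) _ _ _ uF vol0 ps p hm hps hp s f) => //.
- exact: measurable_grid_cube.
- exact: measurable_grid_tent.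
- exact: grid_laminar.
- by move=> i r _; rewrite -gE dual_mass_gt0 hfin.
- by rewrite mulr_ge0// powR_ge0.
move=> E mE EW Edisj r rF.
set nu := fun x => \prod_(i < m) s i x `^ (p / ps i).
pose Q : cube R n := closed_grid_cube al r.
have mnu : measurable_fun setT nu.
  by apply: measurable_prod => i _; apply: (measurableT_comp (measurable_powR _)).
have nu0 x : 0 <= nu x by apply: prodr_ge0 => i _; exact: powR_ge0.
rewrite -(integral_closed_grid_cube al r mnu nu0).
apply: le_trans (testing_cube Q).
pose dens (t : index) : R :=
  \prod_(i < m) (fine (\int[leb]_(x in grid_cube al t) (s i x)%:E) / (2 ^ t.1) ^+ n).
(* [E t] lies in the tent of a cell inside [Q], hence in [tent Q], so its measure is an integral
   over that tent. *)
rewrite (eq_bigr (fun t : index =>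
    \int[mu]_(z in tent Q) ((dens t `^ p)%:E * (\1_(E t) z)%:E))%E); last first.
  move=> t /asboolP tr.
  rewrite ge0_integralZl_EFin ?powR_ge0//; first last.
  - by apply: measurable_funTS; apply/measurable_EFinP.
  - exact: measurable_tent.
  rewrite integral_indic//; last exact: measurable_tent.
  congr (_ * mu _)%E; apply/esym/setIidl => z /EW [tz /andP[z0 zt]].
  split; first by apply: grid_cube_sub; exact: tr.
  by rewrite z0/=; apply: (lt_le_trans zt); exact: (grid_cube_subset_scale hn tr).
rewrite -big_filter -ge0_integral_sum; first last.
- by move=> t z _; rewrite -EFinM lee_fin mulr_ge0 ?powR_ge0.
- by move=> t; apply: measurable_funeM; apply: measurable_funTS; apply/measurable_EFinP.
- exact: measurable_tent.
apply: ge0_le_integral_nonmeasurable => z zQ.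
- by apply: sume_ge0 => t _; rewrite -EFinM lee_fin mulr_ge0 ?powR_ge0.
- exact: poweR_ge0.
split=> //; set F' := [seq _ <- _ | _].
have [[t [tF' Et]]|nE] := pselect (exists t, t \in F' /\ E t z); last first.
  rewrite big1_seq ?poweR_ge0// => t /= tF'; rewrite indicE memNset ?mule0//.
  by move=> Et; apply: nE; exists t.
have := tF'; rewrite mem_filter => /andP[/asboolP tr tF].
rewrite (bigD1_seq t)//=; last exact: filter_uniq.
rewrite [X in (_ + X)%E]big1_seq ?adde0; last first.
  move=> t' /andP[tt' t'F']; rewrite indicE memNset ?mule0// => Et'.
  have t'F : t' \in F by move: t'F'; rewrite mem_filter => /andP[].
  by move: tt'; rewrite (Edisj _ _ _ t'F tF Et' Et) eqxx.
rewrite indicE mem_set// mule1 -poweR_EFin; apply: poweR_le; first exact: ltW.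
  rewrite lee_fin prodr_ge0// => i _.
  by rewrite divr_ge0 ?fine_ge0 ?integral_ge0 ?(ltW (vol0 t))// => x _; rewrite lee_fin.
have [tz /andP[z0 zt]] := EW _ _ Et.
apply: le_trans (@le_maximal R n m _ z (closed_grid_cube al t) (grid_cube_sub tz) (ltW zt)).
rewrite -prodEFin; apply: lee_prod => i _.
  by rewrite lee_fin divr_ge0 ?fine_ge0 ?integral_ge0 ?(ltW (vol0 t))// => x _; rewrite lee_fin.
rewrite averageE EFinM muleC; apply: lee_wpmul2l.
  by rewrite lee_fin invr_ge0 (ltW (vol0 t)).
rewrite fineK; last first.
  by rewrite ge0_fin_numE -?gE ?hfin// ltW// dual_mass_gt0.
apply: ge0_le_integral_nonmeasurable => x tx; rewrite ?lee_fin//; split.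
  exact: grid_cube_sub.
by rewrite indicE mem_set ?mulr1 ?lee_fin ?ler_norm//; apply: grid_cube_sub; exact: tr.
Qed.

(** Pointwise f <= 1 + f^q for q > 1, and both terms have a finite integral against [s i] on a cell.
    Thus [fine] loses nothing there. *)
Lemma dual_fmass_fin al r i :
  (\int[leb]_(x in grid_cube al r) (f i x * s i x)%:E < +oo)%E.
Proof.
have mpow : measurable_fun setT (fun x => f i x `^ ps i * s i x).
  by apply: measurable_funM => //; apply: (measurableT_comp (measurable_powR _)).
apply: (@le_lt_trans _ _ (\int[leb]_(x in grid_cube al r)
    ((s i x)%:E + (f i x `^ ps i * s i x)%:E))%E).
  apply: ge0_le_integral_nonmeasurable => x rx; first by rewrite lee_fin mulr_ge0.
    by rewrite -EFinD lee_fin addr_ge0// mulr_ge0// powR_ge0.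
  split=> //; rewrite -EFinD lee_fin -{2}[s i x]mul1r -mulrDl ler_wpM2r//.
  have [f1|f1] := leP (f i x) 1; first by rewrite ler_wpDr// powR_ge0.
  rewrite ler_wpDl// -{1}[f i x]powRr1// ler_powR//; exact: ltW.
rewrite ge0_integralD//; first last.
- by apply: measurable_funTS; apply/measurable_EFinP.
- by move=> x _; rewrite lee_fin mulr_ge0 ?powR_ge0.
- by apply: measurable_funTS; apply/measurable_EFinP.
- by move=> x _; rewrite lee_fin.
- exact: measurable_grid_cube.
rewrite lte_add_pinfty//.
  by rewrite -(integral_closed_grid_cube al r (ms i) (s0 i)); exact: hfin.
apply: le_lt_trans (ltry (N i)); apply: le_trans (fN i).
by apply: ge0_le_integral_nonmeasurable => x rx; rewrite ?lee_fin ?mulr_ge0 ?powR_ge0.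
Qed.

Lemma average_grid_le (Q : cube R n) al r i : (Q : set Rn) `<=` grid_cube al r ->
  2 ^ r.1 <= 6 * side Q ->
  (average Q (fun x => f i x * s i x)%R <=
   (6 ^+ n * (fine (\int[leb]_(x in grid_cube al r) (f i x * s i x)%:E) / (2 ^ r.1) ^+ n))%:E)%E.
Proof.
move=> Qr r6; have sQ := side_gt0 Q.
have r0 : 0 < 2 ^ r.1 :> R by exact: exprz_gt0.
rewrite averageE mulrCA EFinM muleC.
have I0 : (0 <= \int[leb]_(x in grid_cube al r) (f i x * s i x)%:E)%E.
  by apply: integral_ge0 => x _; rewrite lee_fin mulr_ge0.
apply: lee_pmul.
- by apply: integral_ge0 => x _; rewrite lee_fin.
- by rewrite lee_fin invr_ge0 exprn_ge0// ltW.
- rewrite fineK; last by rewrite ge0_fin_numE// dual_fmass_fin.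
  apply: ge0_le_integral_nonmeasurable => x Qx; rewrite ?lee_fin ?mulr_ge0//.
  by split; [exact: Qr|rewrite ger0_norm// mulr_ge0].
rewrite lee_fin -exprVn -exprVn -exprMn lerXn2r ?nnegrE ?invr_ge0 ?(ltW sQ)//.
  by rewrite mulr_ge0// invr_ge0 ltW.
by rewrite ler_pdivlMr// mulrC ler_pdivrMr// mulrC.
Qed.

(** An increasing exhaustion of the countable index set by finite duplicate-free lists, for the
    passage from finite families to a whole grid. *)
Let family (k : nat) : seq index := undup (pmap unpickle (iota 0 k)).

Let familyP (r : index) k : (pickle r < k)%N -> r \in family k.
Proof.
move=> rk; rewrite mem_undup mem_pmap; apply/mapP; exists (pickle r).
  by rewrite mem_iota.
by rewrite pickleK.
Qed.

Let family_subset k l : (k <= l)%N -> {subset family k <= family l}.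
Proof.
move=> kl r; rewrite !mem_undup !mem_pmap => /mapP[j jk jr].
apply/mapP; exists j => //; move: jk; rewrite !mem_iota !add0n => /andP[_ jk].
by rewrite (leq_trans jk).
Qed.

(** Each cube admissible at [z] is covered by a cell, of one of the grids, whose tent contains [z].
    The maximal function is thus dominated by a limit of finite-family ones, and monotone
    convergence carries the estimate over. *)
Lemma maximal_dual_estimate :
  (\int[mu]_(z in @half_space R n) maximal (fun i x => f i x * s i x)%R z `^ p <=
   (((6 ^+ n) ^+ m) `^ p * #|{ffun 'I_n -> bool}|%:R *
    (TC `^ p * K * S * \prod_(i < m) N i `^ (p / ps i)))%:E)%E.
Proof.
set c := (6 ^+ n) ^+ m; set B := TC `^ p * K * S * _.
have c0 : 0 <= c :> R by rewrite !exprn_ge0.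
pose M k al (z : Rn * measurableTypeR R) : R := maxover (family k) (grid_tent al) (favg al) z.
have M0 k al z : 0 <= M k al z by exact: maxover_ge0.
(* The maximum over the grids is replaced by the sum of the p-th powers, which costs the number of
   grids. *)
pose Phi k (z : Rn * measurableTypeR R) : R :=
  \sum_(al : {ffun 'I_n -> bool}) c `^ p * M k al z `^ p.
have Phi0 k z : 0 <= Phi k z.
  by apply: sumr_ge0 => al _; rewrite mulr_ge0 ?powR_ge0.
have mM k al : measurable_fun setT (fun z => M k al z `^ p).
  apply: (measurableT_comp (measurable_powR _)); apply: measurable_maxover.
  exact: measurable_grid_tent.
have mPhi k : measurable_fun setT (fun z => (Phi k z)%:E).
  apply/measurable_EFinP; apply: measurable_sum => al.
  by apply: measurable_funM.
have ndPhi z : nondecreasing_seq (fun k => (Phi k z)%:E).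
  move=> k l kl; rewrite lee_fin; apply: ler_sum => al _.
  rewrite ler_wpM2l ?powR_ge0// ge0_ler_powR ?nnegrE ?M0//; first exact: ltW.
  by apply: maxover_subset; exact: family_subset.
pose L z := limn (fun k => (Phi k z)%:E).
have PhiL k z : ((Phi k z)%:E <= L z)%E.
  rewrite /L (cvg_lim _ (ereal_nondecreasing_cvgn (ndPhi z)))//.
  by apply: ereal_sup_ubound; exists k.
have L0 z : (0 <= L z)%E by apply: le_trans (PhiL 0%N z); rewrite lee_fin.
apply: (@le_trans _ _ (\int[mu]_z L z)%E).
  apply: ge0_le_integral_nonmeasurable => z //; first by move=> _; exact: poweR_ge0.
  move=> z0; split=> //; rewrite -(poweRVK p0 (L0 z)).
  apply: poweR_le; [exact: ltW|exact: maximal_ge0|].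
  apply: maximal_le => Q Qz zQ.
  have [al [r [Qr Qr2 r6]]] := grid_cover Q.
  have favg0 : 0 <= favg al r.
    apply: prodr_ge0 => i _; rewrite divr_ge0 ?exprn_ge0 ?exprz_ge0//.
    by rewrite fine_ge0// integral_ge0// => x _; rewrite lee_fin mulr_ge0.
  apply: (@le_trans _ _ (c * favg al r)%:E).
    have -> : c = \prod_(i < m) (6 ^+ n) by rewrite prodr_const card_ord.
    rewrite -big_split/= -prodEFin.
    apply: lee_prod => i _; first exact: average_ge0.
    exact: average_grid_le.
  have cf0 : 0 <= c * favg al r by rewrite mulr_ge0.
  rewrite -(poweRK p0 (_ : 0 <= (c * favg al r)%:E)%E); last by rewrite lee_fin.
  apply: poweR_le; [by rewrite invr_ge0 ltW|exact: poweR_ge0|].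
  apply: le_trans (PhiL (pickle r).+1 z); rewrite poweR_EFin lee_fin powRM//.
  rewrite /Phi (bigD1 al)//= ler_wpDr//.
    by apply: sumr_ge0 => al' _; rewrite mulr_ge0 ?powR_ge0.
  rewrite ler_wpM2l ?powR_ge0// ge0_ler_powR ?nnegrE//; first exact: ltW.
  (* [maxover_geP] concerns positive levels only; a zero average is bounded trivially. *)
  have [/le_trans|fp] := leP (favg al r) 0; first by apply.
  apply/(maxover_geP (family (pickle r).+1) (grid_tent al) (favg al) z fp).
  exists r; split=> //; first exact: familyP.
  by split; [exact: Qr|rewrite z0 (le_lt_trans zQ)].
rewrite monotone_convergence//; last by move=> k z _; rewrite lee_fin.
apply: lime_le.
  apply: ereal_nondecreasing_is_cvgn => k l kl.
  by apply: ge0_le_integral_nonmeasurable => z _; rewrite ?lee_fin//; split=> //; exact: ndPhi.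
apply: nearW => k; rewrite /Phi.
under eq_integral do rewrite -sumEFin.
rewrite ge0_integral_sum//; last 2 first.
- by move=> al; apply/measurable_EFinP/measurable_funM.
- by move=> al z _; rewrite lee_fin mulr_ge0 ?powR_ge0.
apply: (@le_trans _ _ (\sum_(al : {ffun 'I_n -> bool}) (c `^ p * B)%:E)%E); last first.
  by rewrite sumEFin lee_fin sumr_const -[leLHS]mulr_natr mulrAC.
apply: lee_sum => al _; under eq_integral do rewrite EFinM.
rewrite ge0_integralZl_EFin ?powR_ge0//; last 2 first.
- by move=> z _; rewrite lee_fin powR_ge0.
- by apply/measurable_EFinP.
rewrite EFinM; apply: lee_wpmul2l; first by rewrite lee_fin powR_ge0.
by apply: finite_grid_estimate; exact: undup_uniq.
Qed.

End Sufficiency.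

(** * From the testing condition to the dual bound, degenerate cases included *)

Section TestingImpliesBound.
Context {R : realType} {m n : nat}.
Local Notation Rn := (euclidean R n).
Local Notation leb := (lebesgue R n).
Variables (ps : 'I_m -> R) (p : R).
Hypotheses (hm : (0 < m)%N) (hn : (0 < n)%N) (hps : forall i, 1 < ps i).
Hypothesis (hp : p^-1 = \sum_(i < m) (ps i)^-1).
Variable mu : {measure set (Rn * measurableTypeR R) -> \bar R}.
Variable w : 'I_m -> Rn -> R.
Hypotheses (mw : forall i, measurable_fun setT (w i)).
Hypothesis wpos : forall i, {ae leb, forall x, 0 < w i x}.

Let s i := dual_weight (ps i) (w i).
Let ms i : measurable_fun setT (s i).
Proof. exact: measurable_dual_weight. Qed.
Let s0 i x : 0 <= s i x. Proof. exact: powR_ge0. Qed.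
Let p0 : 0 < p. Proof. exact: (exponent_gt0 hm hps hp). Qed.
Let ps0 i : 0 < ps i. Proof. by rewrite (lt_trans _ (hps i)). Qed.

Lemma maximal_eq0 (g : 'I_m -> Rn -> R) i : measurable_fun setT (g i) ->
  {ae leb, forall x, g i x = 0} -> maximal g = fun=> 0%E.
Proof.
move=> mg g0; apply/funext => z; apply/eqP; rewrite eq_le maximal_ge0 andbT.
apply: maximal_le => Q _ _; rewrite (@prode_eq0 _ _ _ i)//.
rewrite (ae_eq_average Q mg (measurable_cst (0 : R)) g0) averageE.
by under eq_integral do rewrite normr0; rewrite integral0 mule0.
Qed.

Lemma average_dual_weight (Q : cube R n) i :
  (average Q (fun x => s i x * \1_Q x)%R =
   ((side Q ^+ n)^-1)%:E * \int[leb]_(x in Q) (s i x)%:E)%E.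
Proof.
rewrite averageE; congr (_ * _)%E; apply: eq_integral => x xQ.
by rewrite indicE xQ mulr1 ger0_norm.
Qed.

Variable TC : R.
Hypotheses (TC0 : 0 <= TC) (hTC : (testing_constant mu ps p w <= TC%:E)%E).

(** The average over [Q] itself is infinite and the others are positive, so the maximal function is
    +oo on the tent, while the testing constant, with the convention of [equotient], keeps its
    integral finite. *)
Lemma testing_tent_null (Q : cube R n) i :
  (\int[leb]_(x in Q) (s i x)%:E = +oo)%E -> mu (tent Q) = 0%E.
Proof.
move=> Qoo; set I := (\int[mu]_(z in tent Q)
  maximal (fun i x => s i x * \1_Q x)%R z `^ p)%E.
have I0 : (0 <= I)%E by apply: integral_ge0 => z _; exact: poweR_ge0.
have Ifin : (I < +oo)%E.
  rewrite ltey; apply/eqP => Ioo.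
  suff : (+oo <= TC%:E :> \bar R)%E by rewrite leye_eq.
  apply: le_trans hTC; apply: ereal_sup_ubound; exists Q => //.
  by rewrite /equotient -/s -/I Ioo poweRyr ?eqxx// gt_eqF// invr_gt0.
have sQ : 0 < (side Q ^+ n)^-1 by rewrite invr_gt0 exprn_gt0// side_gt0.
have Moo z : tent Q z -> maximal (fun i x => s i x * \1_Q x)%R z = +oo%E.
  move=> [Qz /andP[z0 zQ]]; apply/eqP; rewrite -leye_eq.
  apply: le_trans (le_maximal _ Qz (ltW zQ)).
  rewrite (@prode_eqy _ _ _ i)// => [j|].
    by rewrite average_dual_weight mule_gt0// dual_mass_gt0.
  by rewrite average_dual_weight Qoo gt0_muley.
apply/eqP; rewrite eq_le measure_ge0 andbT leNgt; apply/negP => tent0.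
suff : I = +oo%E by move=> Ioo; rewrite Ioo ltxx in Ifin.
rewrite /I (eq_integral (cst +oo%E)) => [|z /set_mem/Moo ->]; last first.
  by rewrite poweRyr// gt_eqF.
by rewrite integral_cst ?gt0_mulye//; exact: measurable_tent.
Qed.

(** Larger concentric cubes also carry infinite mass, and countably many of their tents fill the
    half-space. *)
Lemma testing_half_space_null (Q : cube R n) i :
  (\int[leb]_(x in Q) (s i x)%:E = +oo)%E -> mu (@half_space R n) = 0%E.
Proof.
move=> Qoo.
have sk (k : nat) : 0 < side Q + 2 * k%:R by rewrite ltr_wpDr ?side_gt0.
pose Qk (k : nat) : cube R n :=
  Cube [tuple tnth (corner Q) i - k%:R | i < n] (sk k).
have QQk k : (Q : set Rn) `<=` Qk k.
  move=> x Qx j; rewrite /= tnth_mktuple; have /andP[x1 x2] := Qx j.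
  have k0 : 0 <= k%:R :> R by [].
  by apply/andP; split; lra.
apply: measure_negligible; first exact: measurable_half_space.
apply: (@negligibleS _ _ _ mu (\bigcup_k tent (Qk k))); last first.
  apply: negligible_bigcup => k; apply/negligibleP; first exact: measurable_tent.
  apply: (@testing_tent_null _ i); apply/eqP; rewrite -leye_eq -Qoo.
  by apply: ge0_le_integral_nonmeasurable => x Qx; rewrite ?lee_fin//; split=> //; exact: QQk.
move=> z z0.
pose B := \sum_(j < n) (`|tnth z.1 j| + `|tnth (corner Q) j|).
have jB j : `|tnth z.1 j| + `|tnth (corner Q) j| <= B.
  by rewrite /B (bigD1 j)//= lerDl; apply: sumr_ge0 => k _; rewrite addr_ge0.
have B0 : 0 <= B by apply: sumr_ge0 => k _; rewrite addr_ge0.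
pose k := (Num.truncn (`|z.2| + B)).+1.
have kB : `|z.2| + B < k%:R by exact: truncnS_gt.
have sQ := side_gt0 Q; have z2 := ler_norm z.2; have z2' := normr_ge0 z.2.
exists k => //; split=> /= [j|]; last first.
  have : z.2 < side Q + 2 * k%:R by lra.
  by move=> ->; rewrite andbT.
have key (x c : R) : `|x| + `|c| <= B ->
    c - k%:R <= x <= c - k%:R + (side Q + 2 * k%:R).
  have := ler_norm x; have := ler_norm (- x).
  have := ler_norm c; have := ler_norm (- c).
  by rewrite !normrN => h1 h2 h3 h4 h5; apply/andP; split; lra.
rewrite tnth_mktuple; exact: key.
Qed.

Variable K : R.
Hypothesis hK : reverse_hoelder_bound ps p w K.

(** The factors are the volume loss 6^n of the covering in each of the [m] averages, the number 2^n
    of grids, and the sum of the Doob constants; the last two enter at the level of p-th powers,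
    whence the root. *)
Definition testing_factor : R :=
  (6 ^+ n) ^+ m * (#|{ffun 'I_n -> bool}|%:R * \sum_(i < m) doob_const (ps i)) `^ p^-1.

Lemma testing_dual_bounded : dual_bounded_by mu ps p w (testing_factor * K `^ p^-1 * TC).
Proof.
move=> f fL.
have C0 : 0 <= testing_factor * K `^ p^-1 * TC.
  by rewrite !mulr_ge0 ?exprn_ge0 ?powR_ge0.
have rhs0 : (0 <= (testing_factor * K `^ p^-1 * TC)%:E *
    \prod_(i < m) wnorm (ps i) (dual_weight (ps i) (w i)) (f i))%E.
  by rewrite mule_ge0 ?lee_fin//; apply: prode_ge0 => i _; exact: poweR_ge0.
have pV0 : p^-1 != 0 by rewrite gt_eqF// invr_gt0.
have mf i : measurable_fun setT (f i) by have [] := fL i.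
(* If some dual weight has infinite mass on a cube, the half-space is null and the left side is
   0. *)
have [[Q [i Qoo]]|hfin] := pselect (exists Q : cube R n, exists i,
    (\int[leb]_(x in Q) (s i x)%:E = +oo)%E).
  rewrite (_ : half_space_norm _ _ _ = 0%E)// /half_space_norm.
  rewrite (_ : (\int[mu]_(z in _) _)%E = 0%E) ?poweR0r//.
  apply/eqP; rewrite eq_le integral_ge0 ?andbT => [|z _]; last exact: poweR_ge0.
  apply: (@le_trans _ _ (\int[mu]_(z in @half_space R n) cst +oo z)%E).
    by apply: ge0_le_integral_nonmeasurable => z z0 //=; rewrite ?poweR_ge0 ?leey.
  rewrite integral_cst; last exact: measurable_half_space.
  by rewrite (testing_half_space_null Qoo) mule0.
have {}hfin (Q : cube R n) i : (\int[leb]_(x in Q) (s i x)%:E < +oo)%E.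
  by rewrite ltey; apply/eqP => Qoo; apply: hfin; exists Q, i.
pose J i := (\int[leb]_x (`|f i x| `^ ps i * s i x)%:E)%E.
have J0 i : (0 <= J i)%E.
  by apply: integral_ge0 => x _; rewrite lee_fin mulr_ge0 ?powR_ge0.
have Jfin i : (J i < +oo)%E.
  have [_] := fL i; apply: lty_poweRy.
  by rewrite gt_eqF// invr_gt0.
have mabs i : measurable_fun setT (fun x => `|f i x|) by exact: measurableT_comp.
have mJ i : measurable_fun setT (fun x => (`|f i x| `^ ps i * s i x)%:E).
  apply/measurable_EFinP/measurable_funM => //.
  exact: (measurableT_comp (measurable_powR _)).
(* The estimate requires positive bounds [N i]. If some norm vanishes, [f i] times [s i] is zero
   almost everywhere and the maximal function is 0. *)
have [[i Ji]|Jn0] := pselect (exists i, J i = 0%E).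
  rewrite (@maximal_eq0 _ i); first last.
  - have /(ae_eq_integral_abs leb measurableT (mJ i)) :
        (\int[leb]_x `|(`|f i x| `^ ps i * s i x)%:E| = 0)%E.
      rewrite -[RHS]Ji; apply: eq_integral => x _.
      by rewrite gee0_abs// lee_fin mulr_ge0 ?powR_ge0.
    apply: filterS => x /(_ I) [] /eqP; rewrite mulf_eq0 => /orP[|/eqP sx].
      by rewrite powR_eq0 => /andP[/eqP/normr0_eq0 -> _]; exact: mul0r.
    by rewrite -/(s i x) sx mulr0.
  - by apply: measurable_funM => //; exact: ms.
  rewrite /half_space_norm (eq_integral (cst 0%E)) => [|z _]; last by rewrite poweR0r ?gt_eqF.
  by rewrite integral0 poweR0r.
have absE : maximal (fun i x => f i x * dual_weight (ps i) (w i) x)%R =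
    maximal (fun i x => `|f i x| * s i x)%R.
  apply/funext => z; congr (ereal_sup _); apply: eq_imagel => Q _.
  by apply: eq_bigr => i _; apply: eq_average => x _; rewrite !normrM normr_id.
have N0 i : 0 < fine (J i).
  rewrite fine_gt0// Jfin andbT lt0e J0 andbT; apply/eqP => Ji.
  by apply: Jn0; exists i.
have JE i : J i = (fine (J i))%:E by rewrite fineK// ge0_fin_numE.
have JN i : (J i <= (fine (J i))%:E)%E by rewrite -JE.
have := maximal_dual_estimate hm hn hps hp mw wpos hfin TC0 hTC hK mabs
  (fun i x => normr_ge0 _) N0 JN.
rewrite -absE => H.
have pV : 0 <= p^-1 by rewrite invr_ge0 ltW.
apply: le_trans (poweR_le pV _ H) _; first by apply: integral_ge0 => z _; exact: poweR_ge0.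
have wE i : wnorm (ps i) (dual_weight (ps i) (w i)) (f i) = (fine (J i) `^ (ps i)^-1)%:E.
  by rewrite -poweR_EFin -JE.
have -> : (\prod_(i < m) wnorm (ps i) (dual_weight (ps i) (w i)) (f i) =
    \prod_(i < m) (fine (J i) `^ (ps i)^-1)%:E)%E by exact: eq_bigr.
have K0 := reverse_hoelder_bound_gt0 mw wpos hK.
rewrite prodEFin -EFinM poweR_EFin lee_fin.
set P := \prod_(i < m) _; set c := (6 ^+ n) ^+ m; set q := #|_|%:R; set S := \sum_(i < m) _.
have c0 : 0 <= c by rewrite !exprn_ge0.
have q0 : 0 <= q by [].
have S0 : 0 <= S by apply: sumr_ge0 => i _; rewrite ltW// doob_const_gt0.
have P0 : 0 <= P by apply: prodr_ge0 => i _; exact: powR_ge0.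
have PE : P `^ p^-1 = \prod_(i < m) fine (J i) `^ (ps i)^-1.
  rewrite /P powR_prod => [|i _]; last exact: powR_ge0.
  by apply: eq_bigr => i _; rewrite -powRrM mulrAC divff ?mul1r// gt_eqF.
have -> : c `^ p * q * (TC `^ p * K * S * P) = (c * TC) `^ p * (q * S) * K * P.
  by rewrite powRM//; ring.
rewrite !powRM ?mulr_ge0 ?powR_ge0 ?(ltW K0)// -PE /testing_factor -/c -/q -/S.
rewrite -!powRrM divff ?gt_eqF// !powRr1// powRM//.
by rewrite le_eqVlt; apply/orP; left; apply/eqP; ring.
Qed.

End TestingImpliesBound.

(** * Duality and necessity of the testing condition *)

Section WeightedNorm.
Context {R : realType} {n : nat}.
Local Notation Rn := (euclidean R n).
Local Notation leb := (lebesgue R n).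
Variables (q : R) (v : Rn -> R).
Hypotheses (q1 : 1 < q) (mv : measurable_fun setT v).

Lemma measurable_wnorm_integrand (u g : Rn -> R) :
  measurable_fun setT u -> measurable_fun setT g ->
  measurable_fun setT (fun x => (`|g x| `^ q * u x)%:E).
Proof.
move=> mu mg; apply/measurable_EFinP/measurable_funM => //.
by apply: (measurableT_comp (measurable_powR _)); exact: measurableT_comp.
Qed.

Lemma ae_eq_wnorm (g h : Rn -> R) : measurable_fun setT g -> measurable_fun setT h ->
  {ae leb, forall x, g x = h x} -> wnorm q v g = wnorm q v h.
Proof.
move=> mg mh gh; congr (_ `^ _)%E; apply: ae_eq_integral => //.
- exact: measurable_wnorm_integrand.
- exact: measurable_wnorm_integrand.
- by apply: filterS gh => x -> _.
Qed.

Lemma wnorm_dual_weight (g : Rn -> R) : measurable_fun setT g ->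
  {ae leb, forall x, 0 < v x} ->
  wnorm q v (fun x => g x * dual_weight q v x) = wnorm q (dual_weight q v) g.
Proof.
move=> mg vpos; have ms := measurable_dual_weight q mv.
congr (_ `^ _)%E; apply: ae_eq_integral => //.
- by apply: measurable_wnorm_integrand => //; exact: measurable_funM.
- exact: measurable_wnorm_integrand.
- apply: filterS vpos => x vx _; congr EFin.
  rewrite normrM powRM// (ger0_norm (dual_weight_ge0 _ _ _)) -mulrA.
  by rewrite dual_weight_powR.
Qed.

End WeightedNorm.

(** * Equivalence of the two bounds and necessity of testing *)

Section BoundEquivalence.
Context {R : realType} {m n : nat}.
Local Notation Rn := (euclidean R n).
Local Notation leb := (lebesgue R n).
Variables (ps : 'I_m -> R) (p : R).
Hypothesis hps : forall i, 1 < ps i.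
Variable mu : {measure set (Rn * measurableTypeR R) -> \bar R}.
Variable w : 'I_m -> Rn -> R.
Hypotheses (mw : forall i, measurable_fun setT (w i)).
Hypothesis wpos : forall i, {ae leb, forall x, 0 < w i x}.

Let s i := dual_weight (ps i) (w i).
Let ms i : measurable_fun setT (s i).
Proof. exact: measurable_dual_weight. Qed.
Let s0 i x : 0 <= s i x. Proof. exact: powR_ge0. Qed.

(** The substitution of g times the dual weight for f is reversible up to null sets, which neither
    averages nor norms see. The constant is unchanged, so the two smallest constants agree. *)
Lemma bounded_by_dual C : bounded_by mu ps p w C <-> dual_bounded_by mu ps p w C.
Proof.
split=> H f fL.
  have mf i : measurable_fun setT (f i) by have [] := fL i.
  have E i := wnorm_dual_weight (hps i) (mw i) (mf i) (wpos i).
  under eq_bigr do rewrite -E.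
  apply: H => i; split; first by apply: measurable_funM => //; exact: ms.
  by rewrite E; have [] := fL i.
have mf i : measurable_fun setT (f i) by have [] := fL i.
pose g i x := f i x / s i x.
have mg i : measurable_fun setT (g i).
  have -> : g i = fun x => f i x * s i x `^ (-1).
    by apply/funext => x; rewrite powR_inv1.
  by apply: measurable_funM => //; apply: (measurableT_comp (measurable_powR _)).
have gs i : {ae leb, forall x, g i x * s i x = f i x}.
  apply: filterS (wpos i) => x wx.
  by rewrite /g divfK// gt_eqF// dual_weight_gt0.
have E i : wnorm (ps i) (w i) (f i) = wnorm (ps i) (s i) (g i).
  rewrite -(wnorm_dual_weight (hps i) (mw i) (mg i) (wpos i)).
  apply: ae_eq_wnorm => //; first by apply: measurable_funM => //; exact: ms.
  by apply: filterS (gs i) => x ->.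
under eq_bigr do rewrite E.
have -> : maximal f = maximal (fun i x => g i x * s i x).
  apply/funext => z; congr (ereal_sup _); apply: eq_imagel => Q _.
  apply: eq_bigr => i _; apply: ae_eq_average => //.
    by apply: measurable_funM => //; exact: ms.
  by apply: filterS (gs i) => x ->.
by apply: H => i; split=> //; rewrite -E; have [] := fL i.
Qed.

Hypotheses (hm : (0 < m)%N) (hp : p^-1 = \sum_(i < m) (ps i)^-1).
Let p0 : 0 < p. Proof. exact: (exponent_gt0 hm hps hp). Qed.
Let ps0 i : 0 < ps i. Proof. by rewrite (lt_trans _ (hps i)). Qed.

Variable C : R.
Hypotheses (C0 : 0 < C) (hC : dual_bounded_by mu ps p w C).

(** The sets may differ from one [i] to another, as the truncation argument below requires. *)
Lemma indicator_bound (E : 'I_m -> set Rn) : (forall i, measurable (E i)) ->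
  (forall i, \int[leb]_(x in E i) (s i x)%:E < +oo)%E ->
  (half_space_norm mu p (maximal (fun i x => \1_(E i) x * s i x)%R) <=
   C%:E * \prod_(i < m) (\int[leb]_(x in E i) (s i x)%:E) `^ (ps i)^-1)%E.
Proof.
move=> mE Efin.
have wE i : wnorm (ps i) (s i) \1_(E i) = ((\int[leb]_(x in E i) (s i x)%:E) `^ (ps i)^-1)%E.
  congr (_ `^ _)%E; rewrite [RHS]integral_mkcond; apply: eq_integral => x _.
  rewrite patchE indicE; case: ifPn => xE /=; first by rewrite normr1 powR1 mul1r.
  by rewrite normr0 powR0 ?mul0r// gt_eqF.
rewrite -(eq_bigr _ (fun i _ => wE i)); apply: hC => i; split.
  exact: measurable_indic.
by rewrite wE; apply: poweR_lty.
Qed.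

(** [s i] is finite-valued, so the truncated sets increase to [Q] and monotone convergence
    applies. *)
Lemma truncated_mass (Q : cube R n) i (B : R) :
  (B%:E < \int[leb]_(x in Q) (s i x)%:E)%E ->
  exists k : nat, (B%:E < \int[leb]_(x in Q `&` [set x | (s i x <= k%:R)%R]) (s i x)%:E)%E.
Proof.
move=> BQ; apply: contrapT => nk.
have mQk (k : nat) : measurable (Q `&` [set x : Rn | s i x <= k%:R]).
  apply: measurableI; first exact: measurable_cube.
  rewrite (_ : [set _ | _] = s i @^-1` `]-oo, k%:R]); last first.
    by apply/seteqP; split=> x /=; rewrite in_itv.
  by rewrite -[X in measurable X]setTI; exact: ms.
have UQ : \bigcup_k (Q `&` [set x : Rn | s i x <= k%:R]) = Q.
  apply/seteqP; split=> [x [k _ []]//|x Qx].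
  by exists (Num.truncn (s i x)).+1 => //; split=> //=; rewrite ltW// truncnS_gt.
have : (\int[leb]_(x in \bigcup_k (Q `&` [set x : Rn | (s i x <= k%:R)%R])) (s i x)%:E <= B%:E)%E.
  have ndF : nondecreasing_seq (fun k : nat => Q `&` [set x : Rn | s i x <= k%:R]).
    move=> k l kl; apply/subsetPset => x [Qx /= sx]; split=> //=.
    by rewrite (le_trans sx)// ler_nat.
  have cv := @ge0_nondecreasing_set_cvg_integral _ _ R _ (EFin \o s i) leb ndF mQk.
  have {}cv := cv (fun k => measurable_funTS (proj2 (measurable_EFinP _ _) (ms i)))
    (fun k x _ => s0 i x).
  rewrite -(cvg_lim _ cv)//; apply: lime_le; first by apply/cvg_ex; eexists; exact: cv.
  by apply: nearW => k; rewrite leNgt; apply/negP => Bk; apply: nk; exists k.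
by rewrite UQ leNgt BQ.
Qed.

(** Indicators of truncated sets are tested. With x the truncated mass of [s i0], the left side of
    the bound grows like x and the right side like x^(1/p_i0), so the tent cannot have positive
    measure when x is unbounded. *)
Lemma tent_null_of_infinite_mass (Q : cube R n) i0 :
  (\int[leb]_(x in Q) (s i0 x)%:E = +oo)%E -> mu (tent Q) = 0%E.
Proof.
move=> Qoo; pose Ek i (k : nat) : set Rn := Q `&` [set x : Rn | s i x <= k%:R].
have mEk i k : measurable (Ek i k).
  apply: measurableI; first exact: measurable_cube.
  rewrite (_ : [set _ | _] = s i @^-1` `]-oo, k%:R]); last first.
    by apply/seteqP; split=> x /=; rewrite in_itv.
  by rewrite -[X in measurable X]setTI; exact: ms.
have Ekfin i k : (\int[leb]_(x in Ek i k) (s i x)%:E < +oo)%E.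
  apply: (@le_lt_trans _ _ (\int[leb]_(x in Q) (cst k%:R%:E x))%E).
    by apply: ge0_le_integral_nonmeasurable => x; rewrite ?lee_fin.
  rewrite integral_cst; last exact: measurable_cube.
  by rewrite [X in (_ * X)%E]lebesgue_cube -EFinM ltry.
(* A truncation height for each weight that leaves a positive mass. *)
have /choice[k kP] : forall i, exists k, (0 < \int[leb]_(x in Ek i k) (s i x)%:E)%E.
  by move=> i; apply: truncated_mass; exact: dual_mass_gt0.
apply/eqP; rewrite eq_le measure_ge0 andbT leNgt; apply/negP => tent0.
pose a i (l : nat) := fine (\int[leb]_(x in Ek i l) (s i x)%:E).
have aE i l : (\int[leb]_(x in Ek i l) (s i x)%:E = (a i l)%:E)%E.
  rewrite fineK// ge0_fin_numE//.
  by apply: integral_ge0 => x _; rewrite lee_fin.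
have ak0 i : 0 < a i (k i) by have := kP i; rewrite aE.
have sQ : 0 < (side Q ^+ n)^-1 by rewrite invr_gt0 exprn_gt0// side_gt0.
(* the truncation is only varied for the weight of infinite mass *)
pose kk l i := if i == i0 then l else k i.
pose v := (side Q ^+ n)^-1.
have test l : 0 < a i0 l -> ((\prod_(i < m) (v * a i (kk l i)))%:E * mu (tent Q) `^ p^-1 <=
    (C * \prod_(i < m) a i (kk l i) `^ (ps i)^-1)%:E)%E.
  move=> al0.
  have akk0 i : 0 < a i (kk l i) by rewrite /kk; case: eqP => [->|].
  have P0 : 0 <= \prod_(i < m) (v * a i (kk l i)).
    by apply: prodr_ge0 => i _; rewrite mulr_ge0 ?ltW.
  have := indicator_bound (fun i => mEk i (kk l i)) (fun i => Ekfin i (kk l i)).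
  rewrite (eq_bigr (fun i => (a i (kk l i) `^ (ps i)^-1)%:E)) => [|i _]; last first.
    by rewrite aE poweR_EFin.
  rewrite prodEFin -EFinM; apply: le_trans.
  rewrite -[X in (X * _)%E](poweRK p0) ?lee_fin// -poweRM ?poweR_ge0//.
  apply: poweR_le; first by rewrite invr_ge0 ltW.
    by rewrite mule_ge0// poweR_ge0.
  rewrite -integral_cst; last exact: measurable_tent.
  apply: ge0_le_integral_nonmeasurable => z.
  - by move=> _; exact: poweR_ge0.
  - by move=> _; exact: poweR_ge0.
  move=> [Qz /andP[z0 zQ]]; split=> //=.
  rewrite -poweR_EFin; apply: poweR_le; [exact: ltW|by rewrite lee_fin|].
  apply: le_trans (le_maximal _ Qz (ltW zQ)).
  rewrite -prodEFin; apply: lee_prod => i _; first by rewrite lee_fin mulr_ge0 ?ltW.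
  rewrite averageE EFinM; apply: lee_wpmul2l; first by rewrite lee_fin ltW.
  rewrite -aE; apply: ge0_le_integral_nonmeasurable => x Ex; rewrite ?lee_fin//.
  case: (Ex) => Qx _; split=> //.
  by rewrite indicE mem_set// mul1r ?lee_fin ler_norm.
pose t := fine (mu (tent Q)) `^ p^-1.
pose A' := \prod_(i < m | i != i0) (v * a i (k i)).
pose A'' := \prod_(i < m | i != i0) a i (k i) `^ (ps i)^-1.
have A'0 : 0 < A' by apply: prodr_gt0 => i _; rewrite mulr_gt0.
have A''0 : 0 < A'' by apply: prodr_gt0 => i _; exact: powR_gt0.
have prod_kk l (F : 'I_m -> R -> R) : \prod_(i < m) F i (a i (kk l i)) =
    F i0 (a i0 l) * \prod_(i < m | i != i0) F i (a i (k i)).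
  rewrite (bigD1 i0 isT) /= {1}/kk eqxx; congr (_ * _).
  by apply: eq_bigr => i /negPf ii0; rewrite /kk ii0.
have split1 l := prod_kk l (fun _ x => v * x).
have split2 l := prod_kk l (fun i x => x `^ (ps i)^-1).
(* Testing at the heights [k] alone already bounds the measure of the tent, so that [t] is its true
   root. *)
have tentfin : (mu (tent Q) < +oo)%E.
  rewrite ltey; apply/eqP => mQ; have := test _ (ak0 i0).
  rewrite mQ poweRyr ?gt_eqF ?invr_gt0// gt0_muley ?leye_eq// lte_fin.
  by rewrite split1 -/A' !mulr_gt0.
have t0 : 0 < t by apply: powR_gt0; rewrite fine_gt0// tent0.
pose th := 1 - (ps i0)^-1.
have th0 : 0 < th by rewrite subr_gt0 invf_lt1.
(* The mass of [s i0] at which the two sides of [test] agree; beyond it [test] is violated. *)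
pose B := (C * A'' / (v * A' * t)) `^ th^-1.
have [l Bl] : exists l, (B%:E < \int[leb]_(x in Ek i0 l) (s i0 x)%:E)%E.
  by apply: truncated_mass; rewrite Qoo ltry.
rewrite aE lte_fin in Bl.
have al0 : 0 < a i0 l by apply: le_lt_trans Bl; exact: powR_ge0.
have := test l al0; rewrite split1 split2 -/A' -/A''.
rewrite -(fineK (_ : mu (tent Q) \is a fin_num)) ?ge0_fin_numE// poweR_EFin -/t.
rewrite -EFinM lee_fin; apply/negP; rewrite -ltNge.
have aa : a i0 l `^ (ps i0)^-1 * a i0 l `^ th = a i0 l.
  rewrite -powRD; last by rewrite (gt_eqF al0) implybT.
  have -> : (ps i0)^-1 + th = 1 by rewrite /th; ring.
  by rewrite powRr1// ltW.
have : C * A'' / (v * A' * t) < a i0 l `^ th.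
  have D0 : 0 <= C * A'' / (v * A' * t) by rewrite ltW// divr_gt0 ?mulr_gt0.
  have thn0 : th != 0 by rewrite gt_eqF.
  rewrite -[ltLHS]powRr1// -(mulVf thn0) powRrM.
  by apply: gt0_ltr_powR; rewrite // nnegrE ?powR_ge0 ?ltW.
rewrite ltr_pdivrMr ?mulr_gt0// => H.
rewrite -[X in _ < v * X * _ * _]aa.
have ap0 : 0 < a i0 l `^ (ps i0)^-1 by exact: powR_gt0.
by have := H; rewrite -(ltr_pM2l ap0); congr (_ < _); ring.
Qed.

(** Every [f i] is taken to be the indicator of [Q]. If a dual weight has infinite mass on [Q], the
    tent is null and the quotient is 0. *)
Lemma dual_bounded_testing : (testing_constant mu ps p w <= C%:E)%E.
Proof.
apply: ge_ereal_sup => _ [Q _ <-].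
set I := (\int[mu]_(z in tent Q) _)%E.
have I0 : (0 <= I)%E by apply: integral_ge0 => z _; exact: poweR_ge0.
have [[i0 Qoo]|hfin] := pselect (exists i, (\int[leb]_(x in Q) (s i x)%:E = +oo)%E).
  have -> : I = 0%E.
    apply/eqP; rewrite eq_le I0 andbT.
    apply: (@le_trans _ _ (\int[mu]_(z in tent Q) cst +oo z)%E).
      by apply: ge0_le_integral_nonmeasurable => z z0 //=; rewrite ?poweR_ge0 ?leey.
    by rewrite integral_cst ?(tent_null_of_infinite_mass Qoo) ?mule0//; exact: measurable_tent.
  by rewrite poweR0r ?gt_eqF ?invr_gt0// /equotient /= mul0e lee_fin ltW.
have Qfin i : (\int[leb]_(x in Q) (s i x)%:E < +oo)%E.
  by rewrite ltey; apply/eqP => Qoo; apply: hfin; exists i.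
pose a i := fine (\int[leb]_(x in Q) (s i x)%:E).
have a0 i : 0 < a i by rewrite fine_gt0// dual_mass_gt0/=.
have aE i : (\int[leb]_(x in Q) (s i x)%:E = (a i)%:E)%E.
  by rewrite fineK// ge0_fin_numE// ltW// dual_mass_gt0.
pose y := \prod_(i < m) a i `^ (ps i)^-1.
have y0 : 0 < y by apply: prodr_gt0 => i _; exact: powR_gt0.
have yE : (\prod_(i < m) (\int[leb]_(x in Q) (s i x)%:E) `^ (ps i)^-1 = y%:E)%E.
  by rewrite -prodEFin; apply: eq_bigr => i _; rewrite aE poweR_EFin.
have xy : (I `^ p^-1 <= (C * y)%:E)%E.
  have H : (half_space_norm mu p (maximal (fun i x => \1_Q x * s i x)%R) <= (C * y)%:E)%E.
    rewrite EFinM -yE.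
    exact: (indicator_bound (E := fun=> (Q : set Rn)) (fun=> measurable_cube Q)).
  apply: (le_trans _ H); apply: (poweR_le _ I0); first by rewrite invr_ge0 ltW.
  apply: ge0_le_integral_nonmeasurable => z; try by move=> _; exact: poweR_ge0.
  move=> [Qz /andP[z0 zQ]]; split=> //.
  rewrite (_ : (fun i x => dual_weight (ps i) (w i) x * \1_Q x) =
    (fun i x => \1_Q x * s i x))//.
  by apply/funext => i; apply/funext => x; rewrite mulrC.
rewrite /equotient yE; case: eqP => [Ioo|_].
  by move: xy; rewrite Ioo leye_eq.
by rewrite inver (gt_eqF y0) lee_pdivrMr.
Qed.

End BoundEquivalence.

(** * Comparison of the constants and the equivalence *)

Section Constants.
Context {R : realType} {m n : nat}.
Local Notation Rn := (euclidean R n).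
Variables (ps : 'I_m -> R) (p : R).
Variable mu : {measure set (Rn * measurableTypeR R) -> \bar R}.
Variable w : 'I_m -> Rn -> R.

Lemma testing_constant_ge0 : (0 <= testing_constant mu ps p w)%E.
Proof.
pose Q : cube R n := Cube [tuple 0 | i < n] ltr01.
apply: le_ereal_sup_tmp; eexists; first by exists Q.
rewrite /equotient; case: ifP => _; first exact: leey.
rewrite mule_ge0 ?poweR_ge0// inve_ge0.
by apply: prode_ge0 => i _; exact: poweR_ge0.
Qed.

Lemma testing_factor_gt0 : (0 < m)%N -> (forall i, 1 < ps i) ->
  0 < testing_factor (n := n) ps p.
Proof.
move=> hm hps; apply: mulr_gt0; first by rewrite !exprn_gt0.
apply: powR_gt0; apply: mulr_gt0.
  by rewrite ltr0n; apply/card_gt0P; exists [ffun=> true].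
rewrite (bigD1 (Ordinal hm))//= ltr_wpDr ?doob_const_gt0//.
by apply: sumr_ge0 => i _; rewrite ltW// doob_const_gt0.
Qed.

Lemma dual_bounded_by_le (C C' : R) : C <= C' ->
  dual_bounded_by mu ps p w C -> dual_bounded_by mu ps p w C'.
Proof.
move=> CC' H f fL; apply: le_trans (H f fL) _; apply: lee_wpmul2r.
  by apply: prode_ge0 => i _; exact: poweR_ge0.
by rewrite lee_fin.
Qed.

End Constants.

(** Positivity of the weights almost everywhere makes [dual_weight] the intended negative power,
    since [powR] sends 0 to 0 there. Choosing [c] before the measure and the weights expresses that
    it depends on [n], [m] and [ps] only. *)
Theorem theorem1p4 (R : realType) (m n : nat) (ps : 'I_m -> R) (p : R)
    (hm : (0 < m)%N) (hn : (0 < n)%N)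
    (hps : forall i, 1 < ps i)
    (hp : p^-1 = \sum_(i < m) (ps i)^-1) :
  exists c : R, 0 < c /\
  forall (mu : {measure set (euclidean R n * measurableTypeR R) -> \bar R})
         (w : 'I_m -> euclidean R n -> R),
    (forall i, weight (w i)) ->
    (forall i, {ae lebesgue R n, forall x, 0 < w i x}) ->
    reverse_hoelder ps p w ->
    [/\ (exists C : R, 0 < C /\ bounded_by mu ps p w C) <->
        (exists C : R, 0 < C /\ dual_bounded_by mu ps p w C),
        (exists C : R, 0 < C /\ dual_bounded_by mu ps p w C) <->
        testing_condition mu ps p w,
        (testing_constant mu ps p w <= operator_norm mu ps p w)%E,
        operator_norm mu ps p w = dual_operator_norm mu ps p w &
        forall K : R, reverse_hoelder_constant ps p w K ->
          (dual_operator_norm mu ps p w <=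
             c%:E * (K `^ p^-1)%:E * testing_constant mu ps p w)%E].
Proof.
exists (testing_factor (n := n) ps p); split; first exact: testing_factor_gt0.
move=> mu w hw wpos [K0 RH].
have mw i : measurable_fun setT (w i) by have [] := hw i.
have BD C : bounded_by mu ps p w C <-> dual_bounded_by mu ps p w C.
  exact: bounded_by_dual.
have T0 := testing_constant_ge0 ps p mu w.
have sufficiency K TC : reverse_hoelder_bound ps p w K -> 0 <= TC ->
    (testing_constant mu ps p w <= TC%:E)%E ->
    dual_bounded_by mu ps p w (testing_factor (n := n) ps p * K `^ p^-1 * TC).
  by move=> hK TC0 hTC; exact: testing_dual_bounded.
have necessity C : 0 < C -> dual_bounded_by mu ps p w C ->
    (testing_constant mu ps p w <= C%:E)%E.
  by move=> C0 hC; exact: dual_bounded_testing.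
have normE : operator_norm mu ps p w = dual_operator_norm mu ps p w.
  congr (ereal_inf _); apply/seteqP; split=> _ [C [C0 hC] <-]; exists C => //;
  by split=> //; apply/BD.
split=> //.
- by split=> -[C [C0 hC]]; exists C; split=> //; apply/BD.
- split=> [[C [C0 hC]]|Tfin]; first by apply: le_lt_trans (necessity C C0 hC) (ltry C).
  pose TC := fine (testing_constant mu ps p w).
  have TE : (testing_constant mu ps p w = TC%:E)%E by rewrite fineK// ge0_fin_numE.
  have TC0 : 0 <= TC by exact: fine_ge0.
  pose C := testing_factor (n := n) ps p * K0 `^ p^-1 * TC.
  (* The constant sought must be positive, and [TC] may be 0. *)
  exists (C + 1); split.
    by rewrite ltr_wpDl// !mulr_ge0 ?powR_ge0// ltW// testing_factor_gt0.
  apply: (@dual_bounded_by_le _ _ _ _ _ _ _ C); first by rewrite lerDl.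
  by apply: sufficiency => //; rewrite TE.
- by apply: le_ereal_inf_tmp => _ [C [C0 hC] <-]; apply: necessity => //; apply/BD.
move=> K [hK _].
have K1 : 0 < K `^ p^-1 by apply: powR_gt0; exact: (reverse_hoelder_bound_gt0 mw wpos hK).
have tf0 := testing_factor_gt0 (n := n) p hm hps.
have [Tfin|] := ltP (testing_constant mu ps p w) +oo%E; last first.
  by rewrite leye_eq => /eqP ->; rewrite -EFinM gt0_muley ?leey// lte_fin mulr_gt0.
pose TC := fine (testing_constant mu ps p w).
have TE : (testing_constant mu ps p w = TC%:E)%E by rewrite fineK// ge0_fin_numE.
have TC0 : 0 <= TC by exact: fine_ge0.
(* The infimum runs over positive constants; adding [e] gives an admissible one even when [TC] is
   0. *)
rewrite TE -!EFinM; apply/lee_addgt0Pr => e e0; apply: ereal_inf_lbound.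
exists (testing_factor (n := n) ps p * K `^ p^-1 * TC + e) => //; split=> /=.
  by rewrite ltr_wpDl// !mulr_ge0 ?powR_ge0// ltW.
apply: (@dual_bounded_by_le _ _ _ _ _ _ _ (testing_factor (n := n) ps p * K `^ p^-1 * TC)).
  by rewrite lerDl ltW.
by apply: sufficiency => //; rewrite TE.
Qed.
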